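(* Suppose the branching Assumption (see context) holds, fix $n\ge 1$, and let an admissible algorithm have produced after $n$ steps the leaves $\mathbf{x}_n=\{x_1,\dots,x_n\}\subset\mathcal{L}$, with $\mathcal{F}_n=\sigma(\mathbf{x}_n,\mathcal{D}_{\mathbf{x}_n},(R(x))_{x\in\mathbf{x}_n})$. For all $x\in B_{\mathbf{x}_n}\cup\mathcal{D}_{\mathbf{x}_n}$, define $R_n(x)=\Pr(R(x)=1\mid\mathcal{F}_n)$. These quantities can be computed by backward induction, starting from $\mathbf{x}_n\cup\mathcal{D}_{\mathbf{x}_n}$, as follows: for all $x\in\mathbf{x}_n$, $R_n(x)=R(x)$; for all $x\in\mathcal{D}_{\mathbf{x}_n}$, $R_n(x)=m(\mathcal{K}_x,x)$; and for all $x\in B_{\mathbf{x}_n}\setminus\mathbf{x}_n$, $$R_n(x)=\mathbf{1}_{\{t(x)=0\}}\prod_{y\in\mathcal{C}_x}R_n(y)+\mathbf{1}_{\{t(x)=1\}}\Big(1-\prod_{y\in\mathcal{C}_x}(1-R_n(y))\Big).$$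
   Context: **Trees.** $\mathbb{T}$ is the set of finite words over $\mathbb{N}_*=\{1,2,\dots\}$, seen as the complete ordered tree with root $r$ the empty word. $|x|$ is the length (depth) of $x$. The father $f(x)$ of $x\ne r$ is obtained by deleting the last letter of $x$. $\mathbb{C}_x=\{y:f(y)=x\}$; $\mathbb{T}_x$ is the set consisting of $x$ and all its descendants; $\mathbb{H}_x=\mathbb{C}_{f(x)}\setminus\{x\}$ (brothers of $x$) for $x\neq r$ and $\mathbb{H}_r=\emptyset$. For $y\in\mathbb{T}_x$, $B_{xy}=\{z\in\mathbb{T}_x: y\in\mathbb{T}_z\}$ is the branch from $x$ to $y$. $\mathbb{K}_x=\bigcup_{y\in B_{rx}}(\{y\}\cup\mathbb{H}_y)$. For $\mathbf{x}\subset\mathbb{T}$, $B_{\mathbf{x}}=\bigcup_{x\in\mathbf{x}}B_{rx}$ and $\mathbb{D}_{\mathbf{x}}=(\bigcup_{x\in B_{\mathbf{x}}}\mathbb{H}_x)\setminus B_{\mathbf{x}}$. $\mathcal{S}_f$ is the set of finite subtrees of $\mathbb{T}$ with root $r$ (finite $T\ni r$ with $B_{rx}\subset T$ for all $x\in T$). For $T\in\mathcal{S}_f$, $L_T=\{x\in T:T\cap\mathbb{T}_x=\{x\}\}$ is its set of leaves. **Game.** The game tree is $\mathcal{T}\in\mathcal{S}_f$, with leaves $\mathcal{L}=L_{\mathcal{T}}$. Write $\mathcal{T}_x=\mathcal{T}\cap\mathbb{T}_x$, $\mathcal{C}_x=\mathcal{T}\cap\mathbb{C}_x$, $\mathcal{K}_x=\mathcal{T}\cap\mathbb{K}_x$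 for $x\in\mathcal T$, and $\mathcal{D}_{\mathbf{x}}=\mathcal{T}\cap\mathbb{D}_{\mathbf{x}}$ for $\mathbf{x}\subset\mathcal{T}$. Set $t(x)=1$ if $|x|$ is even and $t(x)=0$ if $|x|$ is odd. Outcomes $R(x)\in\{0,1\}$, $x\in\mathcal{L}$, are given and extended to the minimax values on $\mathcal{T}$ by backward induction: for $x\in\mathcal{T}\setminus\mathcal{L}$, $R(x)=\min_{y\in\mathcal{C}_x}R(y)$ if $t(x)=0$ and $R(x)=\max_{y\in\mathcal{C}_x}R(y)$ if $t(x)=1$. A *uniformly random match* starting from $x\in\mathcal{T}$ goes down from $x$, choosing at each step uniformly among the children in $\mathcal{T}$ of the current node, until a leaf of $\mathcal{T}$ (the resulting leaf) is reached. **Assumption (branching).** $\mathcal{T}$ is a random element of $\mathcal{S}_f$ and, conditionally on $\mathcal{T}$, $(R(x))_{x\in\mathcal{L}}$ are random outcomes in $\{0,1\}$. For $T\in\mathcal{S}_f$ put $A_T=\{T\subset\mathcal{T}\text{ and }\mathcal{D}_{L_T}=\emptyset\}$. For every $T\in\mathcal{S}_f$ with $\Pr(A_T)>0$, the family $\big((\mathcal{T}_x,(R(y))_{y\in\mathcal{L}\cap\mathcal{T}_x}),\,x\in L_T\big)$ is independent conditionally on $A_T$. **The function $m$.** For $T\in\mathcal{S}_f$ with $\Pr(A_T)>0$ and $z\in L_T$ (so $z\in\mathcal{T}$ on $A_T$): $m(T,z)=\Pr(R(z)=1\mid A_T)$. **Admissible algorithm.** Step 1: simulate a uniformly random match from $r$,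 with resulting leaf $x_1$, and set $\mathbf{x}_1=\{x_1\}$. Step $n+1$: choose $z_n\in\mathcal{D}_{\mathbf{x}_n}\cup\mathbf{x}_n$ as $z_n=F(B_{\mathbf{x}_n},\mathcal{D}_{\mathbf{x}_n},(R(x))_{x\in\mathbf{x}_n},X_n)$, where $F$ is a deterministic measurable function and $X_n\sim\mathcal{U}([0,1])$ is independent of everything else. If $z_n\in\mathbf{x}_n$, set $x_{n+1}=z_n$ and $\mathbf{x}_{n+1}=\mathbf{x}_n$. If $z_n\in\mathcal{D}_{\mathbf{x}_n}$, simulate a uniformly random match from $z_n$, with resulting leaf $x_{n+1}$, and set $\mathbf{x}_{n+1}=\mathbf{x}_n\cup\{x_{n+1}\}$. (For $x\in B_{\mathbf{x}_n}\cup\mathcal{D}_{\mathbf{x}_n}$, $\mathcal{K}_x$ is $\mathcal{F}_n$-measurable, as is $\mathcal{C}_x$ if $x\in B_{\mathbf{x}_n}\setminus\mathbf{x}_n$.) Relations between conditional probabilities are understood almost surely. *)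

(* Defs.v *)
(* MathComp / MathComp-Analysis *)
From HB Require Import structures.
From mathcomp Require Export all_boot all_order all_algebra finmap.
From mathcomp Require Export all_classical all_reals all_analysis.

Set Implicit Arguments.
Unset Strict Implicit.
Unset Printing Implicit Defensive.

Export Order.TTheory GRing.Theory Num.Theory.
Global Open Scope classical_set_scope.
Global Open Scope ring_scope.

(* Letters are the positive integers; word is the complete tree. *)
Definition letter := {k : nat | (0 < k)%N}.
Definition word := seq letter.
Definition root : word := [::].

(* junk value at the root: father root = root *)
Definition father (x : word) : word := take (size x).-1 x.

Definition children (x : word) : set word :=
  [set y | y <> root /\ father y = x].

Definition subtree (x : word) : set word := [set y | prefix x y].

Definition brothers (x : word) : set word :=
  if x == root then set0 else children (father x) `\ x.

Definition branch (x y : word) : set word :=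
  [set z | subtree x z /\ subtree z y].

Definition Kset (x : word) : set word :=
  \bigcup_(y in branch root x) ([set y] `|` brothers y).

Definition Bset (X : set word) : set word :=
  \bigcup_(x in X) branch root x.

Definition Dset (X : set word) : set word :=
  (\bigcup_(x in Bset X) brothers x) `\` Bset X.

Definition is_ftree (T : {fset word}) : Prop :=
  root \in T /\ forall x, x \in T -> branch root x `<=` [set` T].

Definition inter (T : {fset word}) (A : set word) : {fset word} :=
  [fset x in T | x \in A]%fset.

Definition leaves (T : {fset word}) : {fset word} :=
  [fset x in T | inter T (subtree x) == [fset x]]%fset.

Definition turn (x : word) : nat := if odd (size x) then 0%N else 1%N.

Definition height (T : {fset word}) : nat := \max_(y <- T) size y.

(* Outcomes in {0, 1} are booleans, so that min is andb and max is orb.  The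
   recursion is on a fuel; see minimax_leaf and minimax_node below. *)
Fixpoint minimax_rec (k : nat) (T : {fset word}) (rho : {fmap word -> bool})
    (x : word) : bool :=
  if x \in leaves T then odflt false rho.[? x]%fmap
  else if k is k'.+1 then
    if turn x == 0%N
    then \big[andb/true]_(y <- inter T (children x)) minimax_rec k' T rho y
    else \big[orb/false]_(y <- inter T (children x)) minimax_rec k' T rho y
  else false.

Definition minimax (T : {fset word}) (rho : {fmap word -> bool}) (x : word) :=
  minimax_rec (height T) T rho x.

(* Probability that a uniformly random match on T started from x ends at y;
   again by recursion on a fuel, see match_prob_leaf and match_prob_node. *)
Fixpoint match_prob_rec (R : realType) (k : nat) (T : {fset word})
    (x y : word) : R :=
  if x \in leaves T then (x == y)%:R
  else if k is k'.+1 then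
    (#|` inter T (children x)|%:R)^-1 *
    \sum_(c <- inter T (children x)) match_prob_rec R k' T c y
  else 0.

Definition match_prob (R : realType) (T : {fset word}) (x y : word) : R :=
  match_prob_rec R (height T) T x y.

Lemma in_inter (T : {fset word}) (A : set word) (x : word) :
  (x \in inter T A) = (x \in T) && (x \in A).
Proof. by rewrite /inter !inE. Qed.

Lemma size_le_height (T : {fset word}) (x : word) :
  x \in T -> (size x <= height T)%N.
Proof. by move=> xT; rewrite /height (big_fsetD1 x)//= leq_maxl. Qed.

Lemma leaf_of_height (T : {fset word}) (x : word) : x \in T ->
  (height T <= size x)%N -> x \in leaves T.
Proof.
move=> xT hx; rewrite /leaves !inE xT /=.
apply/eqP/fsetP => y; rewrite in_inter inE.
apply/andP/eqP => [[yT /set_mem /= /prefixP[s ys]]|->].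
  have := size_le_height yT; rewrite ys size_cat => h.
  have /eqP : size s = 0%N.
    by apply/eqP; rewrite -leqn0 -(leq_add2l (size x)) addn0 (leq_trans h).
  by rewrite size_eq0 => /eqP ->; rewrite cats0.
by split=> //; apply/mem_set; rewrite /subtree /= prefix_refl.
Qed.

Lemma children_size (x y : word) : children x y -> size y = (size x).+1.
Proof. by case=> + <-; case/lastP: y => // s a _; rewrite /father !size_rcons /=
  size_take size_rcons ltnS leqnn. Qed.

Lemma minimax_rec_fuel (T : {fset word}) (rho : {fmap word -> bool})
    (k l : nat) (x : word) : x \in T ->
  (height T <= k + size x)%N -> (height T <= l + size x)%N ->
  minimax_rec k T rho x = minimax_rec l T rho x.
Proof.
elim: k l x => [|k IH] [|l] x xT hk hl //=; case: ifPn => // xL.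
- by rewrite leaf_of_height in xL.
- by rewrite leaf_of_height in xL.
- have E y : y \in inter T (children x) ->
      minimax_rec k T rho y = minimax_rec l T rho y.
    rewrite in_inter => /andP[yT /set_mem /children_size sy].
    by apply: IH => //; rewrite sy addnS -addSn.
  by case: ifP => _; apply: eq_big_seq => y /E.
Qed.

Lemma minimax_leaf (T : {fset word}) (rho : {fmap word -> bool}) (x : word) :
  x \in leaves T -> minimax T rho x = odflt false rho.[? x]%fmap.
Proof. by rewrite /minimax; case: (height T) => [|k] /= ->. Qed.

Lemma minimax_node (T : {fset word}) (rho : {fmap word -> bool}) (x : word) :
  x \in T -> x \notin leaves T ->
  minimax T rho x =
    if turn x == 0%N
    then \big[andb/true]_(y <- inter T (children x)) minimax T rho y
    else \big[orb/false]_(y <- inter T (children x)) minimax T rho y.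
Proof.
move=> xT xL; rewrite {1}/minimax.
rewrite (@minimax_rec_fuel T rho _ (height T).+1) ?leq_addr//; last first.
  by rewrite addSn leqW// leq_addr.
rewrite /= (negbTE xL) /minimax.
by case: ifP.
Qed.

Lemma match_prob_rec_fuel (R : realType) (T : {fset word})
    (k l : nat) (x z : word) : x \in T ->
  (height T <= k + size x)%N -> (height T <= l + size x)%N ->
  match_prob_rec R k T x z = match_prob_rec R l T x z.
Proof.
elim: k l x => [|k IH] [|l] x xT hk hl //=; case: ifPn => // xL.
- by rewrite leaf_of_height in xL.
- by rewrite leaf_of_height in xL.
- congr (_ * _); apply: eq_big_seq => y.
  rewrite in_inter => /andP[yT /set_mem /children_size sy].
  by apply: IH => //; rewrite sy addnS -addSn.
Qed.

Lemma match_prob_leaf (R : realType) (T : {fset word}) (x y : word) :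
  x \in leaves T -> match_prob R T x y = (x == y)%:R.
Proof. by rewrite /match_prob; case: (height T) => [|k] /= ->. Qed.

Lemma match_prob_node (R : realType) (T : {fset word}) (x y : word) :
  x \in T -> x \notin leaves T ->
  match_prob R T x y =
    (#|` inter T (children x)|%:R)^-1 *
    \sum_(c <- inter T (children x)) match_prob R T c y.
Proof.
move=> xT xL; rewrite {1}/match_prob.
rewrite (@match_prob_rec_fuel R T _ (height T).+1) ?leq_addr//; last first.
  by rewrite addSn leqW// leq_addr.
by rewrite /= (negbTE xL).
Qed.

Section Probability.
Context (d : measure_display) (Om : measurableType d) (R : realType).
Variable P : probability Om R.

(* Random element of a countable type carrying the discrete sigma-algebra. *)
Definition discrete_rv (C : Type) (Y : Om -> C) : Prop :=
  forall S : set C, measurable (Y @^-1` S).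

(* Events of the form Y \in S, S an arbitrary set. *)
Definition discrete_events (C : Type) (Y : Om -> C) : set (set Om) :=
  preimage_set_system setT Y setT.

(* Elementary conditional probability, meaningful when P A > 0. *)
Definition condP (A E : set Om) : R := fine (P (E `&` A)) / fine (P A).

(* Z is a version of the conditional probability of E given the
   sub-sigma-algebra G. *)
Definition is_cond_prob (G : set (set Om)) (E : set Om) (Z : Om -> R) : Prop :=
  [/\ forall B : set R, measurable B -> G (Z @^-1` B),
      P.-integrable setT (EFin \o Z) &
      forall A, G A -> (\int[P]_(w in A) (Z w)%:E = P (E `&` A))%E].

(* tree w is the game tree and out w the family of outcomes of its leaves,
   encoded as a finite map whose domain is the set of leaves. *)
Variables (tree : Om -> {fset word}) (out : Om -> {fmap word -> bool}).

Definition random_game : Prop :=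
  [/\ forall w, is_ftree (tree w),
      forall w, domf (out w) = leaves (tree w),
      discrete_rv tree & discrete_rv out].

Definition Aev (T : {fset word}) : set Om :=
  [set w | (T `<=` tree w)%fset /\
           inter (tree w) (Dset [set` leaves T]) = fset0].

Definition subgame (x : word) (w : Om) : {fset word} * {fmap word -> bool} :=
  (inter (tree w) (subtree x),
   (out w).[& inter (leaves (tree w)) (subtree x)]%fmap).

(* Conditional independence of the subgames at the leaves of T; the product
   over all leaves, for arbitrary sets S x, covers all the subfamilies. *)
Definition branching : Prop :=
  forall T : {fset word}, is_ftree T -> (0 < P (Aev T))%E ->
  forall S : word -> set ({fset word} * {fmap word -> bool}),
    condP (Aev T) (\bigcap_(x in [set` leaves T]) (subgame x @^-1` S x)) =
    \prod_(x <- leaves T) condP (Aev T) (subgame x @^-1` S x).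

Definition win (z : word) : set Om :=
  [set w | z \in tree w /\ minimax (tree w) (out w) z = true].

Definition mval (T : {fset word}) (z : word) : R := condP (Aev T) (win z).

(* Both sequences are indexed from 1; x 0 and U 0 are never used. *)
Variables (x : nat -> Om -> word) (U : nat -> {RV P >-> R}).

Definition xs (k : nat) (w : Om) : {fset word} :=
  [fset x i w | i in iota 1 k]%fset.

Definition Dxs (k : nat) (w : Om) : {fset word} :=
  inter (tree w) (Dset [set` xs k w]).

Definition Bxs (k : nat) (w : Om) : {fset word} :=
  fset_set (Bset [set` xs k w]).

Definition observed (k : nat) (w : Om) :
    {fset word} * {fset word} * {fmap word -> bool} :=
  (xs k w, Dxs k w, (out w).[& xs k w]%fmap).

Definition Fsigma (k : nat) : set (set Om) := <<s discrete_events (observed k) >>.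

(* sigma(tree, out, x_1, ..., x_k, U_1, ..., U_l) *)
Definition history (k l : nat) : set (set Om) :=
  <<s discrete_events tree `|` discrete_events out `|`
      (\bigcup_(i in [set i | (1 <= i <= k)%N]) discrete_events (x i)) `|`
      (\bigcup_(i in [set i | (1 <= i <= l)%N])
          preimage_set_system setT (U i) measurable) >>.

Variable F :
  {fset word} -> {fset word} -> {fmap word -> bool} -> R -> word.

Definition zchoice (k : nat) (w : Om) : word :=
  F (Bxs k w) (Dxs k w) (out w).[& xs k w]%fmap (U k w).

(* The first three arguments of F range over countable types, so that F is
   jointly measurable iff it is measurable in its last argument.  The joint law
   is prescribed sequentially: each U_k is independent of all that was drawn
   before it, and each x_{k+1} has a given law conditionally on the whole
   past; adm_choice and adm_stay only constrain almost every outcome. *)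
Record admissible : Prop := {
  adm_F_measurable : forall B D rho (y : word),
    measurable [set u | F B D rho u = y];
  adm_x_measurable : forall k, (1 <= k)%N -> discrete_rv (x k);
  adm_U_uniform : forall k, (1 <= k)%N -> forall B : set R, measurable B ->
    distribution P (U k) B = uniform_prob (@ltr01 R) B;
  adm_U_indep : forall k, (1 <= k)%N -> forall (B : set R) (A : set Om),
    measurable B -> history k k.-1 A ->
    P ((U k @^-1` B) `&` A) = (P (U k @^-1` B) * P A)%E;
  adm_first : forall y,
    is_cond_prob (history 0 0) [set w | x 1 w = y]
      (fun w => match_prob R (tree w) root y);
  adm_choice : forall k, (1 <= k)%N ->
    {ae P, forall w, zchoice k w \in (Dxs k w `|` xs k w)%fset};
  adm_stay : forall k, (1 <= k)%N ->
    {ae P, forall w, zchoice k w \in xs k w -> x k.+1 w = zchoice k w};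
  (* on the event z_k \in D_{x_k}, which belongs to history k k, the law of
     x_{k+1} given the whole past is that of a match from z_k *)
  adm_match : forall k, (1 <= k)%N -> forall y,
    is_cond_prob (history k k)
      [set w | zchoice k w \in Dxs k w /\ x k.+1 w = y]
      (fun w => (zchoice k w \in Dxs k w)%:R *
                match_prob R (tree w) (zchoice k w) y)
}.

End Probability.

(* Main.v *)
Require Import Defs.
From mathcomp Require Import zify.

Set Implicit Arguments.
Unset Strict Implicit.
Unset Printing Implicit Defensive.

(** Call two games alike when they show the same things around a set of leaves
  X: the nodes of Dset X and the outcomes on X.  Given the game, the probability
  that the algorithm finds exactly X is the same for all games of such a class E,
  since the matches only meet nodes whose children are common to all of E.  So
  conditioning on what has been observed amounts to conditioning on E.
    For a node c of B_X or D_X, let T be the trace of Kset c on the tree.  Then E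
  is the intersection of Aev T with one event per leaf z of T, which only concerns
  the subgame at z and is trivial when z is in D_X.  By the branching hypothesis
  for T, the subgames at the leaves of T are thus independent given E, and the one
  at a node of D_X keeps the law it has given Aev T.  Taking c in D_X gives
  m(K_c, c); taking for c a child in B_X of an internal node y makes all the
  children of y leaves of T, which gives the product formula at y directly. *)

(** * The complete tree *)

Lemma interP (T : {fset word}) (A : set word) v :
  reflect (v \in T /\ A v) (v \in inter T A).
Proof. by rewrite in_inter; apply: (iffP andP) => -[? /[!inE]]. Qed.

Lemma leavesP (T : {fset word}) v :
  reflect (v \in T /\ forall u, u \in T -> prefix v u -> u = v) (v \in leaves T).
Proof.
rewrite !inE; apply: (iffP andP) => -[vT].
- move=> /eqP/fsetP vl; split=> // u uT vu; move: (vl u); rewrite inE => h.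
  by apply/eqP; rewrite -h; apply/interP.
- move=> vl; split=> //; apply/eqP/fsetP => u; rewrite inE.
  apply/interP/eqP => [[uT /vl]|->]; first by move/(_ uT).
  by split=> //; apply: prefix_refl.
Qed.

Lemma leavesW (T : {fset word}) v : v \in leaves T -> v \in T.
Proof. by case/leavesP. Qed.

Lemma branch_root v u : branch root v u <-> prefix u v.
Proof. by split=> [[]//|uv]; split=> //; exact: prefix0s. Qed.

Lemma prefix_rconsE (K : eqType) (s t : seq K) a :
  prefix s (rcons t a) = (s == rcons t a) || prefix s t.
Proof.
apply/idP/orP => [|[/eqP->|/prefix_trans->//]]; last 2 first.
- exact: prefix_refl.
- exact: prefix_rcons.
case/prefixP => r; case/lastP: r => [|r b]; first by rewrite cats0 => ->; left.
rewrite -rcons_cat => /rcons_inj[-> _]; right; exact: prefix_prefix.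
Qed.


Lemma ftree_prefix T v u : is_ftree T -> v \in T -> prefix u v -> u \in T.
Proof. by move=> [_ Tb] vT uv; apply: (Tb v vT); apply/branch_root. Qed.

Lemma BsetP X v : Bset X v <-> exists2 x, X x & prefix v x.
Proof.
by split=> [[x Xx /branch_root]|[x Xx vx]]; exists x => //; apply/branch_root.
Qed.

Lemma children_rcons v u : children v u <-> exists a, u = rcons v a.
Proof.
rewrite /children /father /=; split=> [[]|[a ->]].
  case/lastP: u => // u a _; rewrite size_rcons -cats1 take_size_cat// => <-.
  by exists a; rewrite cats1.
split; first by move/(congr1 size); rewrite size_rcons.
by rewrite size_rcons -cats1 take_size_cat.
Qed.

Lemma father_rcons v a : father (rcons v a) = v.
Proof. by have [_ ->] : children v (rcons v a) by apply/children_rcons; exists a. Qed.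

Lemma brothers_rcons v a u :
  brothers (rcons v a) u <-> (exists b, u = rcons v b) /\ u <> rcons v a.
Proof.
rewrite /brothers /root ifF; last by case: (v).
by rewrite father_rcons; split=> -[/children_rcons].
Qed.

Lemma brothers_root u : ~ brothers root u.
Proof. by rewrite /brothers eqxx. Qed.

Lemma brothers_sym u v : brothers u v -> brothers v u.
Proof.
case/lastP: u => [/brothers_root//|u a] /brothers_rcons[[b ->] ba].
by apply/brothers_rcons; split; [exists a|exact/nesym].
Qed.

Lemma brothers_trans u v w : brothers u v -> brothers v w -> w = u \/ brothers u w.
Proof.
case/lastP: u => [/brothers_root//|u a] /brothers_rcons[[b ->] ba].
move/brothers_rcons => [[c ->] cb].
have [->|ca] := eqVneq (rcons u c) (rcons u a); first by left.
by right; apply/brothers_rcons; split; [exists c|exact/eqP].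
Qed.

Lemma KsetP c v :
  Kset c v <-> exists2 b, prefix b c & v = b \/ brothers b v.
Proof.
by split=> [[b /branch_root]|[b bc]]; exists b => //; apply/branch_root.
Qed.

Lemma Kset_brothers c u v : Kset c u -> brothers u v -> Kset c v.
Proof.
move=> /KsetP[b bc [->|bu]] uv; apply/(KsetP c v); exists b => //; first by right.
exact: brothers_trans bu uv.
Qed.

(** A proper ancestor of a brother of [b] is an ancestor of [b]. Together with [Kset_brothers], this
    makes the trace of [Kset c] on a tree a complete subtree. *)
Lemma Kset_prefix c u v : Kset c u -> prefix v u -> Kset c v.
Proof.
move=> /KsetP[b bc [->|bu]] vu; apply/KsetP.
  by exists v; [exact: prefix_trans bc|left].
case/lastP: b bc bu => [_ /brothers_root//|b a] bc.
move=> /brothers_rcons[[e ue] ua]; move: vu; rewrite ue prefix_rconsE.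
case/orP => [/eqP->|vb].
  by exists (rcons b a) => //; right; apply/brothers_rcons; rewrite -ue;
      split=> //; exists e.
by exists v; [exact: prefix_trans (prefix_trans vb (prefix_rcons b a)) bc|left].
Qed.

Lemma Bset_prefix X u v : Bset X u -> prefix v u -> Bset X v.
Proof.
by move=> /BsetP[x Xx ux] vu; apply/BsetP; exists x => //; exact: prefix_trans ux.
Qed.

Lemma DsetP X v : Dset X v <-> (exists2 b, Bset X b & brothers b v) /\ ~ Bset X v.
Proof. by split=> -[[b Bb bv] vB]; split=> //; exists b. Qed.

Lemma Bset_tree T X : is_ftree T -> X `<=` [set` T] -> Bset X `<=` [set` T].
Proof. by move=> Tt XT v /BsetP[x /XT /= xT vx]; exact: ftree_prefix vx. Qed.

(** The ancestors of [c] are in [Bset X], except [c] itself when it is in [Dset X], and brothers of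
    nodes of either set stay in the union. Hence what is observed determines the trace of
    [Kset c]. *)
Lemma Kset_BD X c : (Bset X `|` Dset X) c -> Kset c `<=` Bset X `|` Dset X.
Proof.
have B b v : Bset X b -> brothers b v -> (Bset X `|` Dset X) v.
  move=> Bb bv; have [|nB] := pselect (Bset X v); [by left|right].
  by apply/DsetP; split=> //; exists b.
move=> Xc v /KsetP[b bc bv].
have [Bb|] := pselect (Bset X b).
  by case: bv => [->|]; [left|exact: B].
case: Xc => [/Bset_prefix /(_ bc)//|Dc] nBb.
(* A proper ancestor of a node of [Dset X] is in [Bset X]. *)
have bE : b = c.
  case/DsetP: Dc => -[e Be ec] _.
  case/lastP: e Be ec => [_ /brothers_root//|e a] Be /brothers_rcons[[a' ce] _].
  move: bc; rewrite ce prefix_rconsE => /orP[/eqP//|be].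
  by case: nBb; apply: Bset_prefix Be (prefix_trans be (prefix_rcons _ _)).
case: bv => [->|bv]; first by right; rewrite bE.
move: bv; rewrite bE => cv; case/DsetP: Dc => -[e Be ec] _.
by case: (brothers_trans ec cv) => [->|]; [left|exact: B].
Qed.

(* The nodes of Dset X hang below Bset X, so two of them are never comparable. *)
Lemma Dset_prefix X v y : Dset X y -> (Bset X `|` Dset X) v -> prefix y v -> v = y.
Proof.
move=> /DsetP[_ nBy] [Bv yv|/DsetP[[b Bb]]].
  by case: nBy; exact: Bset_prefix Bv yv.
case/lastP: b Bb => [_ /brothers_root//|b a] Bb /brothers_rcons[[e ->] _] _.
rewrite prefix_rconsE => /orP[/eqP//|yb]; case: nBy.
by apply: Bset_prefix Bb (prefix_trans yb (prefix_rcons _ _)).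
Qed.

Lemma leaf_below (T : {fset word}) v : v \in T ->
  exists2 l, l \in leaves T & prefix v l.
Proof.
move: {2}(height T - size v)%N (leqnn (height T - size v)%N) => k.
elim: k v => [|k IH] v hk vT.
  by exists v; [rewrite leaf_of_height// -subn_eq0 -leqn0|exact: prefix_refl].
have [vl|] := boolP (v \in leaves T); first by exists v => //; exact: prefix_refl.
move=> /leavesP nl; have [u [uT vu uv]] : exists u, [/\ u \in T, prefix v u & u <> v].
  apply: contra_notP nl => nu; split=> // u uT vu.
  by apply: contrapT => uv; apply: nu; exists u.
have suv : (size v < size u)%N.
  move: vu uv => /prefixP[[|a s] ->]; first by rewrite cats0.
  by rewrite size_cat /= addnS ltnS leq_addr.
have [|l lL ul] := IH u _ uT; first by have := size_le_height uT; lia.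
by exists l => //; exact: prefix_trans ul.
Qed.

Lemma ftree_Bset_leaves T : is_ftree T -> Bset [set` leaves T] = [set` T].
Proof.
move=> Tt; apply/seteqP; split.
  by apply: Bset_tree => // v /= /leavesW.
by move=> v /= /leaf_below[l lL vl]; apply/BsetP; exists l.
Qed.

(** * Games *)

Lemma in_interT (T : {fset word}) (A : set word) v :
  A v -> (v \in inter T A) = (v \in T).
Proof. by move=> Av; rewrite in_inter (mem_set Av) andbT. Qed.

Lemma prefix_sizeE (K : eqType) (s t : seq K) :
  prefix s t -> (size t <= size s)%N -> t = s.
Proof.
move=> /prefixP[[|a r] ->]; first by rewrite cats0.
by rewrite size_cat /= addnS => h; exfalso; lia.
Qed.

Lemma Kset_refl c : Kset c c.
Proof. by apply/KsetP; exists c; [exact: prefix_refl|left]. Qed.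

Lemma Kset_trans c u : Kset c u -> Kset u `<=` Kset c.
Proof.
move=> cu v /KsetP[b bu vb]; have cb := Kset_prefix cu bu.
by case: vb => [->//|]; exact: Kset_brothers.
Qed.

Lemma Kset_brothersE c u : brothers c u -> Kset u = Kset c.
Proof.
move=> cu; apply/seteqP; split; apply: Kset_trans.
  exact: Kset_brothers (Kset_refl c) cu.
exact: Kset_brothers (Kset_refl u) (brothers_sym cu).
Qed.

(** No node of [Kset c] is longer than [c], so none lies strictly below it. *)
Lemma Kset_leaf t c : c \in t -> c \in leaves (inter t (Kset c)).
Proof.
move=> ct; apply/leavesP; split; first by apply/interP; split=> //; exact: Kset_refl.
move=> u /interP[_ /KsetP[b bc ub]] cu; apply: prefix_sizeE => //.
suff -> : size u = size b by exact: size_prefix.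
case: ub => [->//|]; case/lastP: b {bc} => [/brothers_root//|b a].
by move=> /brothers_rcons[[e ->] _]; rewrite !size_rcons.
Qed.

Lemma Kset_ftree t c : is_ftree t -> is_ftree (inter t (Kset c)).
Proof.
move=> Ft; split; first apply/interP.
  by split; [case: Ft|apply/(Kset_prefix (Kset_refl c))/prefix0s].
move=> v /interP[vt cv] u /branch_root uv; apply/interP.
by split; [exact: ftree_prefix uv|exact: Kset_prefix uv].
Qed.

(** [Kset c] is closed under brothers, so nothing in [t] hangs off its trace. This is the second
    condition in [Aev]. *)
Lemma Kset_complete t c : is_ftree t ->
  inter t (Dset [set` leaves (inter t (Kset c))]) = fset0.
Proof.
move=> Ft; apply/fsetP => v; rewrite in_fset0; apply/negP => /interP[vt /DsetP[]].
rewrite ftree_Bset_leaves; last exact: Kset_ftree.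
move=> [b /= /interP[_ cb] bv]; apply; apply/interP; split=> //.
exact: Kset_brothers cb bv.
Qed.

(** Going down from the root to [v], the path can leave [T] only at a leaf of [T]: elsewhere, a
    child outside [T] would be the brother of one inside, hence a node of the empty trace of
    [Dset]. *)
Lemma complete_below T t v : is_ftree T -> is_ftree t -> (T `<=` t)%fset ->
  inter t (Dset [set` leaves T]) = fset0 -> v \in t ->
  v \in T \/ exists2 z, z \in leaves T & prefix z v.
Proof.
move=> FT Ft Tt cT; elim/last_ind: v => [|v a IH] vat.
  by left; case: FT.
have [vT|[z zT zv]] := IH (ftree_prefix Ft vat (prefix_rcons _ _)); last first.
  by right; exists z => //; exact: prefix_trans zv (prefix_rcons _ _).
have [vaT|vaT] := boolP (rcons v a \in T); [by left|right].
exists v; last exact: prefix_rcons.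
apply/leavesP; split=> // u uT /prefixP[[|b s] ue]; first by rewrite ue cats0.
have vbT : rcons v b \in T.
  by apply: ftree_prefix uT _ => //; rewrite ue -cat_rcons prefix_prefix.
have : rcons v a \in inter t (Dset [set` leaves T]); last by rewrite cT in_fset0.
apply/interP; split=> //; apply/DsetP; rewrite ftree_Bset_leaves//; split;
  last exact/negP.
exists (rcons v b) => //; apply/brothers_rcons; split; first by exists a.
by move=> vab; move: vaT; rewrite vab vbT.
Qed.

Lemma leaves_subtree t z : leaves (inter t (subtree z)) = inter (leaves t) (subtree z).
Proof.
apply/fsetP => v; apply/leavesP/interP => [[/interP[vt zv] vl]|[/leavesP[vt vl] zv]].
  split=> //; apply/leavesP; split=> // u ut vu; apply: vl => //.
  by apply/interP; split=> //; exact: prefix_trans vu.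
by split=> [|u /interP[ut _] vu]; [apply/interP|exact: vl].
Qed.

(** * Subgames, and games that look alike *)

Definition game := ({fset word} * {fmap word -> bool})%type.

Definition is_game (g : game) := is_ftree g.1 /\ domf g.2 = leaves g.1.

Definition below (z : word) (g : game) : game :=
  (inter g.1 (subtree z), g.2.[& inter (leaves g.1) (subtree z)]%fmap).

(** With the same fuel the two recursions coincide below [z]; the fuel is then adjusted, the subtree
    being no higher than the tree. *)
Lemma minimax_below z (g : game) : z \in g.1 ->
  minimax (below z g).1 (below z g).2 z = minimax g.1 g.2 z.
Proof.
move=> zg; set t := g.1; set o := g.2.
have key k v : v \in t -> prefix z v ->
    minimax_rec k (below z g).1 (below z g).2 v = minimax_rec k t o v.
  elim: k v => [|k IH] v vt zv /=; rewrite leaves_subtree fnd_restrict.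
    have -> : (v \in inter (leaves t) (subtree z)) = (v \in leaves t).
      by apply/interP/idP => [[]|].
    by case: ifP => // ->.
  have -> : (v \in inter (leaves t) (subtree z)) = (v \in leaves t).
    by apply/interP/idP => [[]|].
  case: ifP => [->//|_].
  have -> : inter (inter g.1 (subtree z)) (children v) = inter t (children v).
    apply/fsetP => u; apply/interP/interP => [[/interP[? ?] ?]|[ut vu]]; first by [].
    split=> //; apply/interP; split=> //.
    by case/children_rcons: vu => a ->; exact: prefix_trans zv (prefix_rcons _ _).
  by case: ifP => _; apply: eq_big_seq => u /interP[ut /children_rcons[a ue]];
    apply: IH => //; rewrite ue; exact: prefix_trans zv (prefix_rcons _ _).
have zz := prefix_refl z; rewrite -[RHS]key//.
have zb : z \in (below z g).1 by apply/interP.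
apply: minimax_rec_fuel => //; rewrite ?leq_addr//.
rewrite (leq_trans _ (leq_addr _ _))// /height.
apply/bigmax_leqP_seq => u /interP[ut _] _.
exact: size_le_height.
Qed.

(** The clauses reflect the components of [observed] when the leaves found are [X]. That [X]
    consists of leaves of [g0] is assumed separately in the lemmas. *)
Definition similar (X : {fset word}) (g0 g : game) :=
  [/\ (X `<=` leaves g.1)%fset, inter g.1 (Dset [set` X]) = inter g0.1 (Dset [set` X])
    & g.2.[& X]%fmap = g0.2.[& X]%fmap].

Lemma similar_mem X g0 g v : is_game g0 -> is_game g ->
  (X `<=` leaves g0.1)%fset -> similar X g0 g ->
  (Bset [set` X] `|` Dset [set` X]) v -> (v \in g.1) = (v \in g0.1).
Proof.
move=> [F0 _] [F _] X0 [Xg Dg _] [Bv|Dv].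
  by rewrite !(Bset_tree _ _ Bv)// => u /= uX; apply/leavesW; apply/fsubsetP: uX.
by have /fsetP/(_ v) := Dg; rewrite !in_interT.
Qed.

Lemma fsubset_Bset (X X' : {fset word}) :
  (X `<=` X')%fset -> Bset [set` X] `<=` Bset [set` X'].
Proof.
move=> XX' v /BsetP[x xX vx]; apply/BsetP; exists x => //.
by apply/fsubsetP: xX.
Qed.

Lemma fsubset_BD (X X' : {fset word}) : (X `<=` X')%fset ->
  Bset [set` X] `|` Dset [set` X] `<=` Bset [set` X'] `|` Dset [set` X'].
Proof.
move=> XX' v [/(fsubset_Bset XX')|/DsetP[[b /(fsubset_Bset XX') Bb bv] _]]; first by left.
by apply: (Kset_BD (c := b)); [left|exact: Kset_brothers (Kset_refl b) bv].
Qed.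

(** Finding fewer leaves shows less: [Dset X] lies within the union of [Bset] and [Dset] of [X'],
    where both trees agree. *)
Lemma similarW X X' g0 g : is_game g0 -> is_game g -> (X `<=` X')%fset ->
  (X' `<=` leaves g0.1)%fset -> similar X' g0 g -> similar X g0 g.
Proof.
move=> G0 G XX' X'0 S; have [X'g Dg og] := S; split.
- exact: fsubset_trans X'g.
- apply/fsetP => v; rewrite !in_inter.
  have [/set_mem Dv|_] := boolP (v \in Dset [set` X]); rewrite ?andbF// !andbT.
  by apply: similar_mem S _ => //; apply: (fsubset_BD XX'); right.
- have /fsetIidPr <- := XX'.
  by rewrite -!restrictf_comp og.
Qed.

Lemma similar_Kset X g0 g c : is_game g0 -> is_game g ->
  (X `<=` leaves g0.1)%fset -> similar X g0 g ->
  (Bset [set` X] `|` Dset [set` X]) c ->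
  inter g.1 (Kset c) = inter g0.1 (Kset c).
Proof.
move=> G0 G X0 S BDc; apply/fsetP => v; rewrite !in_inter.
have [/set_mem Dv|_] := boolP (v \in Kset c); rewrite ?andbF// !andbT.
by apply: similar_mem S _ => //; exact: Kset_BD Dv.
Qed.

Lemma below_mem z g1 g v : below z g1 = below z g -> prefix z v ->
  (v \in g1.1) = (v \in g.1).
Proof. by move=> /(congr1 fst)/fsetP/(_ v) + zv; rewrite !in_interT. Qed.

Lemma below_leaves z g1 g v : below z g1 = below z g -> prefix z v ->
  (v \in leaves g1.1) = (v \in leaves g.1).
Proof.
move=> /(congr1 fst) /= h zv; have := leaves_subtree g1.1 z; rewrite h leaves_subtree.
by move=> /fsetP/(_ v); rewrite !in_interT.
Qed.

Lemma below_fnd z g1 g v : below z g1 = below z g -> prefix z v ->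
  v \in leaves g.1 -> g1.2.[? v]%fmap = g.2.[? v]%fmap.
Proof.
move=> h zv vg; have vg1 : v \in leaves g1.1 by rewrite (below_leaves h).
move: h => /(congr1 (fun g : game => g.2.[? v]%fmap)) /=.
by rewrite !fnd_restrict !in_interT// vg vg1.
Qed.

(** This is why a class of similar games is a product event: the subgame at each leaf of the trace
    may be borrowed from a different game [g1] of the class, and it is free at a node of [Dset X],
    since nothing below has been seen. *)
Lemma similar_glue X g0 g c : is_game g0 -> is_game g ->
  (X `<=` leaves g0.1)%fset ->
  c \in g0.1 -> (Bset [set` X] `|` Dset [set` X]) c ->
  (inter g0.1 (Kset c) `<=` g.1)%fset ->
  inter g.1 (Dset [set` leaves (inter g0.1 (Kset c))]) = fset0 ->
  (forall z, z \in leaves (inter g0.1 (Kset c)) -> ~ Dset [set` X] z ->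
    exists g1, [/\ is_game g1, similar X g0 g1 & below z g1 = below z g]) ->
  similar X g0 g.
Proof.
move=> G0 G X0 c0 BDc Tg cTg glue; set T := inter g0.1 (Kset c) in Tg cTg glue.
have [[F0 d0] [F d]] := (G0, G).
have FT : is_ftree T by exact: Kset_ftree.
have T0 : (T `<=` g0.1)%fset by apply/fsubsetP => v /interP[].
have cT0 : inter g0.1 (Dset [set` leaves T]) = fset0 by exact: Kset_complete.
have gX v : v \in X -> v \in leaves g.1 /\ g.2.[? v]%fmap = g0.2.[? v]%fmap.
  move=> vX; have /leavesP[v0 vl] : v \in leaves g0.1 by apply/fsubsetP: vX.
  have [z zT zv] : exists2 z, z \in leaves T & prefix z v.
    have [vT|//] := complete_below FT F0 T0 cT0 v0.
    exists v; last exact: prefix_refl.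
    by apply/leavesP; split=> // u /(fsubsetP T0); exact: vl.
  (* A node of [Dset X] is outside [Bset X], so no leaf of [X] lies below it. *)
  have nDz : ~ Dset [set` X] z.
    by move=> /DsetP[_]; apply; apply/BsetP; exists v.
  have [g1 [G1 [X1 _ o1] zg]] := glue _ zT nDz.
  have v1 : v \in leaves g1.1 by apply/fsubsetP: vX.
  have vg : v \in leaves g.1 by rewrite -(below_leaves zg).
  split=> //; rewrite -(below_fnd zg)//.
  have /(congr1 (fun o : {fmap word -> bool} => o.[? v]%fmap)) := o1.
  by rewrite !fnd_restrict vX.
split; first by apply/fsubsetP => v /gX[].
- suff key v : Dset [set` X] v -> v \in g.1 \/ v \in g0.1 -> (v \in g.1) = (v \in g0.1).
    apply/fsetP => v; apply/interP/interP => -[vg Dv]; split=> //.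
      by rewrite -key//; left.
    by rewrite key//; right.
  move=> Dv vgg.
  have [vT|[z zT zv]] : v \in T \/ exists2 z, z \in leaves T & prefix z v.
    by case: vgg; apply: complete_below.
    by rewrite (fsubsetP Tg _ vT) (fsubsetP T0 _ vT).
  (* Below a leaf in [Dset X] the only node of [Dset X] is that leaf, which lies in both trees;
     below another leaf, membership is read off the witness. *)
  have [Dz|nDz] := pselect (Dset [set` X] z).
    have vz : v = z by apply: Dset_prefix Dz _ zv; right.
    have vT : v \in T by rewrite vz; exact: leavesW.
    by rewrite (fsubsetP Tg _ vT) (fsubsetP T0 _ vT).
  have [g1 [G1 S1 zg]] := glue _ zT nDz.
  by rewrite -(below_mem zg)//; apply: similar_mem S1 _ => //; right.
- apply/fmapP => v; rewrite !fnd_restrict; case: ifP => // vX.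
  by case: (gX v vX).
Qed.

(** * Matches on similar games *)

Section MatchProb.
Variable R : realType.

Lemma match_prob_rec_neq0 k (t : {fset word}) v y :
  match_prob_rec R k t v y != 0 -> y \in leaves t /\ prefix v y.
Proof.
elim: k v => [|k IH] v /=; case: ifPn => [vt|_]; rewrite ?eqxx//.
- by have [<- _|_] := eqVneq v y; [split=> //; exact: prefix_refl|rewrite eqxx].
- by have [<- _|_] := eqVneq v y; [split=> //; exact: prefix_refl|rewrite eqxx].
rewrite mulf_eq0 negb_or => /andP[_] s0.
have [c] : exists2 c, c \in inter t (children v) & match_prob_rec R k t c y != 0.
  apply: contraNP s0 => nc; rewrite big_seq big1// => c ct.
  by apply/eqP; apply: contra_notT nc => ?; exists c.
move=> /interP[_ /children_rcons[a ->]] /IH[yt vay]; split=> //.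
exact: prefix_trans (prefix_rcons _ _) vay.
Qed.

Lemma match_prob_eq0 (t : {fset word}) v y :
  ~ (y \in leaves t /\ prefix v y) -> match_prob R t v y = 0.
Proof. by move=> h; apply/eqP; apply: contra_notT h; exact: match_prob_rec_neq0. Qed.

(** Before it ends at [y], a match only visits nodes of the branch to [y], whose children lie in
    [Bset X] or [Dset X]. Both trees thus offer the same children at each step. *)
Lemma match_prob_similar X g0 g y v : is_game g0 -> is_game g ->
  (X `<=` leaves g0.1)%fset -> similar X g0 g -> y \in X ->
  v \in g.1 -> v \in g0.1 -> match_prob R g.1 v y = match_prob R g0.1 v y.
Proof.
move=> G0 G X0 S yX; have [Xg _ _] := S.
have y0 : y \in leaves g0.1 by apply/fsubsetP: yX.
have yg : y \in leaves g.1 by apply/fsubsetP: yX.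
move: {2}(size y - size v)%N (leqnn (size y - size v)%N) => k.
elim: k v => [|k IH] v hk vg v0.
all: have [vy|nvy] := boolP (prefix v y); last
  by rewrite !match_prob_eq0// => -[_ vy]; rewrite vy in nvy.
all: have [<-|yv] := eqVneq y v; first by rewrite !match_prob_leaf.
  by case/eqP: yv; apply: prefix_sizeE vy _; rewrite -subn_eq0 -leqn0.
have nl t : y \in leaves t -> v \notin leaves t.
  by move=> yt; apply: contraNN yv => /leavesP[_ /(_ y (leavesW yt) vy)] ->.
rewrite !match_prob_node ?nl//.
(* The children of [v] are the next node towards [y], which is in [Bset X], and its brothers. *)
have Ec : inter g.1 (children v) = inter g0.1 (children v).
  have [b vb] : exists b, prefix (rcons v b) y.
    case/prefixP: vy yv => -[|b s] ->; first by rewrite cats0 eqxx.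
    by exists b; rewrite -cat_rcons prefix_prefix.
  have Bb : Bset [set` X] (rcons v b) by apply/BsetP; exists y.
  apply/fsetP => u; rewrite !in_inter.
  have [/set_mem vu|_] := boolP (u \in children v); rewrite ?andbF// !andbT.
  apply: similar_mem S _ => //; apply: (Kset_BD (c := rcons v b)); first by left.
  case/children_rcons: vu => a ->.
  have [->|ab] := eqVneq (rcons v a) (rcons v b); first exact: Kset_refl.
  apply: Kset_brothers (Kset_refl _) _; apply/brothers_rcons; split; first by exists a.
  exact/eqP.
rewrite Ec; congr (_ * _); apply: eq_big_seq => c c0.
have /interP[cg _] : c \in inter g.1 (children v) by rewrite Ec.
case/interP: c0 => c0 /children_size cs; apply: IH => //.
by rewrite cs subnS; case: (size y - size v)%N hk.
Qed.
End MatchProb.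

(** * Discrete random variables *)

Section DiscreteIn.
Variables (T : Type) (H : set (set T)).
Hypothesis sH : sigma_algebra setT H.

(** The sigma-algebra is a parameter because it stands both for the measurable sets and for the
    histories of the algorithm. *)
Definition discrete_in (C : Type) (Y : T -> C) := forall S : set C, H (Y @^-1` S).

Lemma salg_setC A : H A -> H (~` A).
Proof. by case: sH => _ HC _ /HC; rewrite setTD. Qed.

Lemma salg_bigcup (I : countType) (A : I -> set T) :
  (forall i, H (A i)) -> H (\bigcup_i A i).
Proof.
move=> HA; have [H0 _ HU] := sH.
have -> : \bigcup_i A i = \bigcup_n (if choice.unpickle n is Some i then A i else set0).
  apply/seteqP; split=> t [i _ Ai].
    by exists (choice.pickle i); rewrite ?choice.pickleK.
  by case: choice.unpickle Ai => // j Aj; exists j.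
by apply: HU => n; case: choice.unpickle.
Qed.

Lemma salg_setI A B : H A -> H B -> H (A `&` B).
Proof.
move=> HA HB.
rewrite (_ : A `&` B = ~` \bigcup_b (if b then ~` A else ~` B)).
  by apply/salg_setC/salg_bigcup => -[]; exact: salg_setC.
apply/seteqP; split=> t; first by move=> [At Bt] [[] _].
move=> nU; split; apply: contrapT => ?; apply: nU; first by exists true.
by exists false.
Qed.

Lemma discrete_in_pair (C : countType) (C' : Type) (Y : T -> C) (Y' : T -> C') :
  discrete_in Y -> discrete_in Y' -> discrete_in (fun t => (Y t, Y' t)).
Proof.
move=> HY HY' S.
rewrite (_ : _ @^-1` _ =
  \bigcup_c ((Y @^-1` [set c]) `&` (Y' @^-1` [set c' | S (c, c')]))).
  by apply: salg_bigcup => c; exact: salg_setI.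
apply/seteqP; split=> t /=; first by exists (Y t).
by move=> [c _ [/= -> ]].
Qed.

Lemma discrete_in_comp (C C' : Type) (f : C -> C') (Y : T -> C) :
  discrete_in Y -> discrete_in (fun t => f (Y t)).
Proof. by move=> HY S; exact: HY (f @^-1` S). Qed.

Lemma discrete_in_cst (C : Type) (c : C) : discrete_in (fun _ => c).
Proof.
move=> S; have [H0 _ _] := sH; have [Sc|nSc] := pselect (S c).
  by rewrite preimage_cst mem_set// -setC0; exact: salg_setC.
by rewrite preimage_cst memNset.
Qed.

End DiscreteIn.

(** * Almost sure events and conditional probabilities *)

Section Probability.
Context (d : measure_display) (Om : measurableType d) (R : realType).
Variable P : probability Om R.
Let mA := sigma_algebra_measurable Om.

Lemma ae_forall_count (I : countType) (Q : I -> Om -> Prop) :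
  (forall i, {ae P, forall w, Q i w}) -> {ae P, forall w, forall i, Q i w}.
Proof.
move=> Qi; have := @ae_foralln _ _ _ P
  (fun n w => if choice.unpickle n is Some i then Q i w else True).
have h n : {ae P, forall w, if choice.unpickle n is Some i then Q i w else True}.
  by case: choice.unpickle => [i|]; [exact: Qi|exact: aeW].
move=> /(_ h); apply: filterS => w Qw i.
by have := Qw (choice.pickle i); rewrite choice.pickleK.
Qed.

Lemma ae_prob0 (Q : Om -> Prop) A : measurable A -> {ae P, forall w, Q w} ->
  (forall w, Q w -> ~ A w) -> P A = 0%E.
Proof.
move=> mA' aQ QA; apply: measure_negligible => //.
by apply: negligibleS aQ => w Aw Qw; exact: QA Qw Aw.
Qed.

Lemma prob_aeE (Q : Om -> Prop) A B : measurable A -> measurable B ->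
  B `<=` A -> {ae P, forall w, Q w} -> (forall w, Q w -> A w -> B w) -> P A = P B.
Proof.
move=> mA' mB BA aQ QAB.
have -> : P A = (P (A `\` B) + P (A `&` B))%E by exact: measureDI.
have -> : P (A `\` B) = 0%E.
  by apply: ae_prob0 aQ _; [exact: measurableD|move=> w Qw [/(QAB _ Qw)]].
by rewrite add0e; move/setIidr : BA => ->.
Qed.

Lemma prob_partition (I : countType) (f : Om -> I) A : measurable A ->
  discrete_rv f -> P A = (\sum_(n <oo) P (A `&` [set w | choice.pickle (f w) = n]))%E.
Proof.
move=> mA' df; have AE : A = \bigcup_n (A `&` [set w | choice.pickle (f w) = n]).
  rewrite -setI_bigcupr; apply/seteqP; split=> [w Aw|w []//].
  by split=> //; exists (choice.pickle (f w)).
have mn n : measurable (A `&` [set w | choice.pickle (f w) = n]).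
  by apply: measurableI => //; exact: df [set i | choice.pickle i = n].
rewrite {1}AE measure_semi_bigcup//; last by rewrite -AE.
by move=> i j _ _ [w [[_ /= <-] [_ /= <-]]].
Qed.

(** On [A] the version [Z] is constant, so its defining integral is a product. The laws of the
    matches are used in this form. *)
Lemma is_cond_prob_cst (H : set (set Om)) Ev Z A c : is_cond_prob P H Ev Z ->
  H A -> measurable A -> (forall w, A w -> Z w = c) ->
  P (Ev `&` A) = (c%:E * P A)%E.
Proof.
move=> [_ _ /(_ A)] HZ HA mA' Zc; rewrite -HZ// -integral_cst//.
by apply: eq_integral => w /set_mem /Zc ->.
Qed.

(* q is P (A | Y \in E); without division, a null event Y \in E needs no
   separate treatment. *)
Definition cond_free (C : Type) (Y : Om -> C) (E : set C) (A : set Om) :=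
  exists q : R, forall S : set C, S `<=` E ->
    P (Y @^-1` S `&` A) = (q%:E * P (Y @^-1` S))%E.

Section CondFree.
Context (C : Type) (Y : Om -> C).
Hypothesis dY : discrete_rv Y.

Lemma cond_free0 (E : set C) A : measurable A -> P (Y @^-1` E `&` A) = 0%E ->
  cond_free Y E A.
Proof.
move=> mA' PE; exists 0%R => S SE; rewrite mul0e; apply/eqP.
rewrite eq_le measure_ge0 andbT -PE le_measure ?inE//.
- exact: measurableI.
- exact: measurableI.
- by apply: setSI => w; exact: SE.
Qed.

(** The factors of the pieces are never summed: cross-multiplied identities are, and a single
    division by the probability of [E] gives [q]. *)
Lemma cond_free_partition (I : countType) (f : Om -> I) (E : set C) A :
  measurable A -> discrete_rv f ->
  (forall i, cond_free Y E (A `&` f @^-1` [set i])) -> cond_free Y E A.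
Proof.
move=> mA' df fi; have [PE0|PE0] := eqVneq (P (Y @^-1` E)) 0%E.
  apply: cond_free0 => //; apply/eqP; rewrite eq_le measure_ge0 andbT -PE0.
  by rewrite le_measure ?inE//; exact: measurableI.
have fE : P (Y @^-1` E) \is a fin_num by exact: fin_num_measure.
have mEA : measurable (Y @^-1` E `&` A) by exact: measurableI.
exists (fine (P (Y @^-1` E `&` A)) / fine (P (Y @^-1` E))) => S SE.
have mSA : measurable (Y @^-1` S `&` A) by exact: measurableI.
(* Each piece contributes the same term to both series: its own factor times the probabilities of
   [E] and [S]. *)
have key : ((fine (P (Y @^-1` E)))%:E * P (Y @^-1` S `&` A) =
   (fine (P (Y @^-1` S)))%:E * P (Y @^-1` E `&` A))%E.
  rewrite (prob_partition mSA df) (prob_partition mEA df).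
  rewrite -!nneseriesZl//; apply: eq_eseriesr => n _.
  have [[i ni]|nf] := pselect (exists i : I, choice.pickle i = n).
    have [q qE] := fi i.
    have eB (B : set C) : Y @^-1` B `&` A `&` [set w | choice.pickle (f w) = n] =
        Y @^-1` B `&` (A `&` f @^-1` [set i]).
      rewrite -setIA; congr (_ `&` (_ `&` _)); apply/seteqP; split=> w /=.
        by rewrite -ni => /(pcan_inj choice.pickleK).
      by move=> ->.
    rewrite !eB !qE// !fineK//; last exact: fin_num_measure.
    by rewrite muleCA [RHS]muleCA; congr (_ * _)%E; rewrite muleC.
  suff e0 B : B `&` [set w | choice.pickle (f w) = n] = set0 :> set Om.
    by rewrite !e0 !measure0 !mule0.
  by apply/seteqP; split=> w // [_ fw]; apply: nf; exists (f w).
have fSA : P (Y @^-1` S `&` A) \is a fin_num by exact: fin_num_measure.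
have fEA : P (Y @^-1` E `&` A) \is a fin_num by exact: fin_num_measure.
have fS : P (Y @^-1` S) \is a fin_num by exact: fin_num_measure.
move: key; rewrite -(fineK fSA) -(fineK fEA) -(fineK fS) -!EFinM => -[key].
congr _%:E; have e0 : fine (P (Y @^-1` E)) != 0 by rewrite fine_eq0.
by apply: (mulfI e0); rewrite key mulrA mulrCA divff// mulr1 mulrC.
Qed.

End CondFree.
End Probability.

(** * The algorithm *)

Section Algorithm.
Context (d : measure_display) (Om : measurableType d) (R : realType).
Variable P : probability Om R.
Variables (tree : Om -> {fset word}) (out : Om -> {fmap word -> bool}).
Variables (x : nat -> Om -> word) (U : nat -> {RV P >-> R}).
Variable F : {fset word} -> {fset word} -> {fmap word -> bool} -> R -> word.
Hypothesis RG : random_game tree out.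
Hypothesis adm : admissible tree out x U F.

Let mA := sigma_algebra_measurable Om.
Let X := xs x.

Definition the_game (w : Om) : game := (tree w, out w).
Local Notation G := the_game.
Local Notation zc := (zchoice tree out x U F).

Lemma the_gameP w : is_game (G w).
Proof. by case: RG => T0 O0 _ _; split; [exact: T0|exact: O0]. Qed.

Lemma history_salg k l : sigma_algebra setT (history tree out x U k l).
Proof. exact: smallest_sigma_algebra. Qed.

Lemma the_game_history k l : discrete_in (history tree out x U k l) G.
Proof.
apply: discrete_in_pair; first exact: history_salg.
  by move=> S; apply: sub_sigma_algebra; left; left; left; exists S => //; rewrite setTI.
by move=> S; apply: sub_sigma_algebra; left; left; right; exists S => //; rewrite setTI.
Qed.

Lemma the_game_rv : discrete_rv G.
Proof. by case: RG => _ _ mt mo; apply: discrete_in_pair. Qed.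

Lemma xsP k w v : v \in X k w <-> exists2 i, (1 <= i <= k)%N & v = x i w.
Proof.
split=> [/imfsetP[i ik ->]|[i ik ->]].
  by exists i => //; have : i \in iota 1 k by []; rewrite mem_iota add1n ltnS.
by apply/imfsetP; exists i => //; change (i \in iota 1 k); rewrite mem_iota add1n ltnS.
Qed.

Lemma xs0 w : X 0 w = fset0.
Proof. by apply/fsetP => v; rewrite in_fset0; apply/negP => /xsP[[|i]]. Qed.

Lemma xsS k w : X k.+1 w = (x k.+1 w |` X k w)%fset.
Proof.
apply/fsetP => v; rewrite in_fset1U; apply/idP/orP.
  move=> /xsP[i /andP[i0]]; rewrite leq_eqVlt => /orP[/eqP-> ->|ik ->]; first by left.
  by right; apply/xsP; exists i => //; rewrite i0.
case=> [/eqP->|/xsP[i /andP[i0 ik] ->]]; apply/xsP.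
  by exists k.+1; rewrite //= leqnn.
by exists i => //; rewrite i0 ltnW.
Qed.

Lemma xs_discrete H k : sigma_algebra setT H ->
  (forall i, (1 <= i <= k)%N -> discrete_in H (x i)) -> discrete_in H (X k).
Proof.
move=> sH; elim: k => [|k IH] Hx.
  rewrite (_ : X 0 = fun=> fset0); first exact: discrete_in_cst.
  by apply/funext => w; exact: xs0.
have -> : X k.+1 = fun w => (x k.+1 w |` X k w)%fset.
  by apply/funext => w; exact: xsS.
apply: (discrete_in_comp (fun p : word * {fset word} => (p.1 |` p.2)%fset)
  (Y := fun w => (x k.+1 w, X k w))).
apply: discrete_in_pair => //; first by apply: Hx; rewrite ltnSn.
by apply: IH => i /andP[i0 ik]; apply: Hx; rewrite i0 ltnW.
Qed.

Lemma xs_history k l : discrete_in (history tree out x U k l) (X k).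
Proof.
apply: xs_discrete; first exact: history_salg.
move=> i ik S; apply: sub_sigma_algebra; left; right; exists i => //.
by exists S => //; rewrite setTI.
Qed.

Lemma xs_rv k : discrete_rv (X k).
Proof.
apply: xs_discrete; first exact: mA.
by move=> i /andP[i1 _] S; exact: (adm_x_measurable adm).
Qed.

Lemma history_measurable k l A : history tree out x U k l A -> measurable A.
Proof.
case: RG => _ _ mt mo; apply: smallest_sub; first exact: mA.
move=> B [[[]|[i ik]]|[i ik]] [S mS <-]; rewrite setTI.
- exact: mt.
- exact: mo.
- by apply: (adm_x_measurable adm); case/andP: ik.
- by rewrite -[_ @^-1` _]setTI; exact: measurable_funPT.
Qed.

Lemma U_history k l B : (1 <= k <= l)%N -> measurable B ->
  history tree out x U l l (U k @^-1` B).
Proof.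
move=> kl mB; apply: sub_sigma_algebra; right; exists k => //.
by exists B => //; rewrite setTI.
Qed.

(** The choice with the observations frozen: for fixed [p] it depends on the uniform variable alone,
    so that independence applies. *)
Definition choice_fun (p : {fset word} * game) (u : R) : word :=
  F (fset_set (Bset [set` p.1])) (inter p.2.1 (Dset [set` p.1])) p.2.2.[& p.1]%fmap u.

Lemma zchoiceE k w : zc k w = choice_fun (X k w, G w) (U k w).
Proof. by []. Qed.

Lemma choice_fun_measurable p S : measurable (choice_fun p @^-1` S).
Proof.
have -> : choice_fun p @^-1` S =
    \bigcup_y (if y \in S then choice_fun p @^-1` [set y] else set0).
  apply/seteqP; split=> u /=.
    by move=> Su; exists (choice_fun p u) => //; rewrite mem_set.
  by move=> [y _]; case: ifP => // /set_mem Sy /= ->.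
apply: (salg_bigcup (sigma_algebra_measurable R)) => y; case: ifP => // _.
exact: (adm_F_measurable adm).
Qed.

Lemma zchoice_history k : (1 <= k)%N -> discrete_in (history tree out x U k k) (zc k).
Proof.
move=> k1 S.
have -> : zc k @^-1` S = \bigcup_p ((fun w => (X k w, G w)) @^-1` [set p] `&`
    U k @^-1` (choice_fun p @^-1` S)).
  apply/seteqP; split=> w /=; first by move=> Sw; exists (X k w, G w).
  by move=> [p _ [<-]].
apply: (salg_bigcup (history_salg k k)) => p; apply: (salg_setI (history_salg k k)).
  apply: discrete_in_pair; first exact: history_salg.
    exact: xs_history.
  exact: the_game_history.
by apply: U_history; [rewrite k1 leqnn|exact: choice_fun_measurable].
Qed.

Lemma x_rv k : (1 <= k)%N -> discrete_rv (x k).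
Proof. by move=> k1; exact: (adm_x_measurable adm). Qed.

Lemma zchoice_rv k : (1 <= k)%N -> discrete_rv (zc k).
Proof. by move=> k1 S; apply: history_measurable (zchoice_history k1 S). Qed.

(** A match ends at a non-leaf with probability zero, and there are only countably many words; an
    algorithm that stays repeats a leaf already found. *)
Lemma xs_leaves k : (1 <= k)%N -> {ae P, forall w, (X k w `<=` leaves (tree w))%fset}.
Proof.
case: k => // k _; elim: k => [|k IH].
  have : {ae P, forall w, forall y, ~ (x 1 w = y /\ y \notin leaves (tree w))}.
    apply: ae_forall_count => y; set A := [set w | x 1 w = y /\ y \notin leaves (tree w)].
    have mB : history tree out x U 0 0 (G @^-1` [set g | y \notin leaves g.1]).
      exact: the_game_history.
    exists A; split=> //; last by move=> w /= /contrapT.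
      apply: measurableI; first exact: (x_rv (ltn0Sn _) [set y]).
      exact: history_measurable mB.
    rewrite (is_cond_prob_cst (adm_first adm y) mB (c := 0)) ?mul0e//.
      exact: history_measurable mB.
    by move=> w /= /negP yl; apply: match_prob_eq0 => -[].
  apply: filterS => w /(_ (x 1 w)) xl; rewrite xsS xs0 fsetU0 fsub1set.
  by apply: contrapT => /negP xnl; apply: xl.
have : {ae P, forall w, forall y,
    ~ ((zc k.+1 w \in Dxs tree x k.+1 w /\ x k.+2 w = y) /\ y \notin leaves (tree w))}.
  apply: ae_forall_count => y.
  set Ev := [set w | zc k.+1 w \in Dxs tree x k.+1 w /\ x k.+2 w = y].
  have mB : history tree out x U k.+1 k.+1 (G @^-1` [set g | y \notin leaves g.1]).
    exact: the_game_history.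
  exists (Ev `&` G @^-1` [set g | y \notin leaves g.1]); split=> //;
    last by move=> w /= /contrapT.
    apply: measurableI; last exact: history_measurable mB.
    apply: measurableI; last exact: (x_rv (ltn0Sn _) [set y]).
    have H : discrete_rv (fun w => (zc k.+1 w, (X k.+1 w, G w))).
      apply: discrete_in_pair; [exact: mA|exact: zchoice_rv|].
      by apply: discrete_in_pair; [exact: mA|exact: xs_rv|exact: the_game_rv].
    exact: H [set p | p.1 \in inter p.2.2.1 (Dset [set` p.2.1])].
  rewrite (is_cond_prob_cst (adm_match adm _ y) mB (c := 0)) ?mul0e//.
    exact: history_measurable mB.
  by move=> w /= /negP yl; rewrite match_prob_eq0 ?mulr0// => -[].
have xz : {ae P, forall w,
    x k.+2 w \in leaves (tree w) \/ zc k.+1 w \in Dxs tree x k.+1 w}.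
  move: IH (adm_choice adm (ltn0Sn k)) (adm_stay adm (ltn0Sn k)).
  apply: filterS3 => w Xl + stay; rewrite in_fsetU => /orP[zD|zX]; first by right.
  by left; rewrite stay//; apply/fsubsetP: zX.
move: IH xz; apply: filterS3 => w Xl xz zD.
rewrite xsS fsubUset fsub1set; apply/andP; split=> //.
case: xz => // zDx; apply: contrapT => /negP xnl.
by apply: (zD (x k.+2 w)).
Qed.

(** * The law of the leaves found, given a class of games *)

Definition alike (S : {fset word}) (g0 : game) : set game :=
  [set g | is_game g /\ similar S g0 g].

Lemma alikeW S S' g0 : is_game g0 -> (S `<=` S')%fset -> (S' `<=` leaves g0.1)%fset ->
  alike S' g0 `<=` alike S g0.
Proof. by move=> G0 SS S'0 g [Gg Sg]; split=> //; exact: similarW Sg. Qed.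

(* The matches only see the part of the tree common to all the games of
   alike S g0, so their conditional law is the same for all these games. *)
Lemma xs_free k S g0 : (1 <= k)%N -> is_game g0 -> (S `<=` leaves g0.1)%fset ->
  cond_free P G (alike S g0) [set w | X k w = S].
Proof.
case: k => // k _ G0; elim: k S => [|k IH] S Sg0.
  have mX : measurable [set w | X 1 w = S] by exact: (xs_rv _ [set S]).
  apply: (cond_free_partition the_game_rv mX (x_rv (leqnn 1))) => y.
  have mXy : measurable ([set w | X 1 w = S] `&` x 1 @^-1` [set y]).
    by apply: measurableI => //; exact: x_rv.
  have [yS|yS] := eqVneq S [fset y]%fset; last first.
    apply: cond_free0 => //; first exact: the_game_rv.
    rewrite (_ : _ `&` _ = set0) ?measure0//; apply/seteqP; split=> // w [_ /= [XS xy]].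
    by case/eqP: yS; rewrite -XS xsS xs0 fsetU0 xy.
  have -> : [set w | X 1 w = S] `&` x 1 @^-1` [set y] = [set w | x 1 w = y].
    apply/seteqP; split=> w /=; first by case.
    by move=> xy; rewrite xsS xs0 fsetU0 xy -yS.
  exists (match_prob R g0.1 root y) => T TE; rewrite setIC.
  apply: is_cond_prob_cst (adm_first adm y) _ _ _;
    [exact: the_game_history|exact: the_game_rv|].
  move=> w /TE[Gw Sw]; apply: match_prob_similar Sw _ _ _ => //; first by rewrite yS inE.
    by case: Gw => -[].
  by case: G0 => -[].
have mX : measurable [set w | X k.+2 w = S] by exact: (xs_rv _ [set S]).
(* The last step is split by the leaves found before it, the choice made and the resulting leaf. *)
pose f w := (X k.+1 w, zc k.+1 w, x k.+2 w).
have df : discrete_rv f.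
  apply: discrete_in_pair; [exact: mA| |exact: x_rv].
  by apply: discrete_in_pair; [exact: mA|exact: xs_rv|exact: zchoice_rv].
apply: (cond_free_partition the_game_rv mX df) => -[[S1 z] y].
have mXf : measurable ([set w | X k.+2 w = S] `&` f @^-1` [set (S1, z, y)]).
  by apply: measurableI => //; exact: df.
have null0 : (forall w, alike S g0 (G w) ->
    ~ ([set w | X k.+2 w = S] `&` f @^-1` [set (S1, z, y)]) w) ->
    cond_free P G (alike S g0) ([set w | X k.+2 w = S] `&` f @^-1` [set (S1, z, y)]).
  move=> no; apply: cond_free0 => //; first exact: the_game_rv.
  by rewrite (_ : _ `&` _ = set0) ?measure0//; apply/seteqP; split=> // w [/no].
have [SE|SE] := eqVneq S (y |` S1)%fset; last first.
  by apply: null0 => w _ [/= XS [XS1 _ xy]]; case/eqP: SE; rewrite -XS xsS XS1 xy.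
have -> : [set w | X k.+2 w = S] `&` f @^-1` [set (S1, z, y)] = f @^-1` [set (S1, z, y)].
  by apply/setIidr => w /= [XS1 _ xy]; rewrite xsS XS1 xy -SE.
have S1S : (S1 `<=` S)%fset by rewrite SE; exact: fsubsetUr.
have aS1 := alikeW G0 S1S Sg0.
have [q qE] := IH _ (fsubset_trans S1S Sg0).
pose B := choice_fun (S1, g0) @^-1` [set z].
have mB : measurable B by exact: choice_fun_measurable.
(* Every game of the class shows around [S1] what [g0] shows, so choosing [z] means that [U k.+1]
   falls in [B], independently of the past. *)
have choiceE T : T `<=` alike S g0 ->
    P (G @^-1` T `&` [set w | X k.+1 w = S1] `&` zc k.+1 @^-1` [set z]) =
    ((fine (P (U k.+1 @^-1` B)) * q)%:E * P (G @^-1` T))%E.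
  move=> TE; rewrite EFinM -muleA -qE; last exact: subset_trans aS1.
  rewrite fineK; last first.
    apply: fin_num_measure; apply: history_measurable (k.+1) (k.+1) _ _.
    by apply: U_history => //; rewrite leqnn.
  rewrite -(adm_U_indep adm)//; last first.
    apply: (salg_setI (history_salg _ _)); first exact: the_game_history.
    by have := @xs_history k.+1 k [set S1].
  congr (P _); rewrite setIC; apply/seteqP; split=> w [] /=.
    move=> zw [Tw XS1]; split=> //; rewrite /B /= -zw zchoiceE XS1.
    by case: (aS1 _ (TE _ Tw)) => _ [_ Dw ow]; rewrite /choice_fun /= -Dw -ow.
  move=> Bw [Tw XS1]; split=> //; rewrite zchoiceE XS1 -[RHS]Bw.
  by case: (aS1 _ (TE _ Tw)) => _ [_ Dw ow]; rewrite /choice_fun /= Dw ow.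
have mGT T : measurable (G @^-1` T `&` [set w | X k.+1 w = S1] `&` zc k.+1 @^-1` [set z]).
  apply: measurableI; last exact: zchoice_rv.
  by apply: measurableI; [exact: the_game_rv|exact: (xs_rv _ [set S1])].
have mGf T : measurable (G @^-1` T `&` f @^-1` [set (S1, z, y)]).
  by apply: measurableI; [exact: the_game_rv|exact: df].
have nullP (Q : Om -> Prop) : {ae P, forall w, Q w} ->
    (forall w, Q w -> alike S g0 (G w) -> f w <> (S1, z, y)) ->
    cond_free P G (alike S g0) (f @^-1` [set (S1, z, y)]).
  move=> aQ Qn; apply: cond_free0; [exact: the_game_rv|exact: df|].
  by apply: ae_prob0 aQ _ => // w Qw [aw fw]; exact: Qn fw.
(* If [z] has been found already, the next leaf is almost surely [z], and the factor is that of the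
   choice. *)
have [zS1|zS1] := boolP (z \in S1).
  have [yz|yz] := eqVneq y z; last first.
    apply: (nullP _ (adm_stay adm (ltn0Sn k))) => w stay _ [XS1 zw xy].
    by case/eqP: yz; rewrite -xy stay zw// -/(X _ _) XS1.
  exists (fine (P (U k.+1 @^-1` B)) * q) => T TE; rewrite -choiceE//.
  apply/esym; apply: prob_aeE (adm_stay adm (ltn0Sn k)) _ => //.
    by move=> w [Tw [XS1 zw _]].
  move=> w stay [[/= Tw XS1] zw]; split=> //=.
  have xz : x k.+2 w = z by rewrite -zw stay// zw -/(X _ _) XS1.
  by rewrite /f XS1 zw xz yz.
(* A choice that is neither already found nor available in [g0] has probability zero. *)
have [zD|zD] := boolP (z \in inter g0.1 (Dset [set` S1])); last first.
  apply: (nullP _ (adm_choice adm (ltn0Sn k))) => w + aw [XS1 zw _].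
  rewrite in_fsetU zw -/(X _ _) XS1 (negbTE zS1) orbF /Dxs -/(X _ _) XS1.
  by case: (aS1 _ aw) => _ [_ /= -> _]; rewrite (negbTE zD).
(* A new match from [z] multiplies the factor of the choice by its probability on [g0], which all
   games of the class share. *)
exists (match_prob R g0.1 z y * (fine (P (U k.+1 @^-1` B)) * q)) => T TE.
rewrite EFinM -muleA -choiceE//.
have Dw w : alike S g0 (G w) -> X k.+1 w = S1 -> z \in Dxs tree x k.+1 w.
  by move=> aw XS1; rewrite /Dxs -/(X _ _) XS1; case: (aS1 _ aw) => _ [_ /= -> _].
rewrite -(is_cond_prob_cst (adm_match adm (ltn0Sn k) y)).
- congr (P _); apply/seteqP; split=> w /=.
    by move=> [Tw [XS1 zw xy]]; split=> //; split=> //; rewrite zw Dw//; exact: TE.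
  by move=> [[_ xy] [[Tw XS1] zw]]; split=> //; rewrite /f XS1 zw xy.
- apply: (salg_setI (history_salg _ _)); last exact: zchoice_history.
  apply: (salg_setI (history_salg _ _)); first exact: the_game_history.
  by have := @xs_history k.+1 k.+1 [set S1].
- exact: mGT.
move=> w [[Tw XS1] zw]; have [Gw Sw] := TE _ Tw.
have zDw := Dw _ (TE _ Tw) XS1.
rewrite zw zDw mul1r; apply: match_prob_similar Sw _ _ _ => //.
- by rewrite SE in_fset1U eqxx.
- by case/interP: zDw.
- by case/interP: zD.
Qed.
End Algorithm.

(** * Consequences of branching *)

Section Branching.
Context (d : measure_display) (Om : measurableType d) (R : realType).
Variable P : probability Om R.
Variables (tree : Om -> {fset word}) (out : Om -> {fmap word -> bool}).
Hypothesis RG : random_game tree out.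
Hypothesis BR : branching P tree out.
Local Notation G := (the_game tree out).
Local Notation sub := (subgame tree out).

Lemma subgame_rv z : discrete_rv (sub z).
Proof. exact: (discrete_in_comp (below z) (the_game_rv RG)). Qed.

Definition winning (z : word) : set game := [set g | z \in g.1 /\ minimax g.1 g.2 z].

(** The minimax value at [z] is computed inside the subgame at [z], so that wins become events
    covered by the branching hypothesis. *)
Lemma win_subgame z : win tree out z = sub z @^-1` winning z.
Proof.
have zz := prefix_refl z.
apply/seteqP; split=> w /= -[zw mz].
  by split; [apply/interP|rewrite (@minimax_below z (G w))].
case/interP: zw => zw _; split=> //.
by rewrite -(@minimax_below z (G w)).
Qed.

Lemma winP z w : win tree out z w <-> winning z (sub z w).
Proof. by rewrite win_subgame. Qed.

Lemma win_measurable z : measurable (win tree out z).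
Proof. by rewrite win_subgame; exact: subgame_rv. Qed.

(** * Independence of the subgames given a class of games *)

Section Given.
Variables (X : {fset word}) (g0 : game) (c : word).
Hypotheses (G0 : is_game g0) (X0 : (X `<=` leaves g0.1)%fset).
Hypotheses (c0 : c \in g0.1) (BDc : (Bset [set` X] `|` Dset [set` X]) c).
Let E : set Om := G @^-1` alike X g0.
Hypothesis PE : P E != 0%E.
Let T := inter g0.1 (Kset c).
Let L := leaves T.

(** What the class demands of the subgame at [z]: that some game of the class has it, or nothing if
    [z] is in [Dset X]. The witness may change with [z]. *)
Definition compatible (z : word) : set game :=
  [set s | ~ Dset [set` X] z -> exists g, alike X g0 g /\ below z g = s].

Lemma compatible_Dset z : Dset [set` X] z -> compatible z = setT.
Proof. by move=> Dz; apply/seteqP; split=> // s _ /=. Qed.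

(** A game of the class is its own witness at every leaf; conversely, the witnesses are glued by
    [similar_glue]. *)
Lemma given_Aev (W : word -> set game) :
  E `&` \bigcap_(z in [set` L]) (sub z @^-1` W z) =
  (\bigcap_(z in [set` L]) (sub z @^-1` (compatible z `&` W z))) `&` Aev tree T.
Proof.
apply/seteqP; split=> w.
  move=> [[Gw Sw] Ww]; split.
    by move=> z zL; split; [exists (G w)|exact: Ww].
  have TE : inter (tree w) (Kset c) = T by exact: similar_Kset Sw BDc.
  split; first by rewrite -TE; apply/fsubsetP => v /interP[].
  by rewrite -TE; apply: Kset_complete; case: Gw.
move=> [Ww [Tw Dw]]; split; last by move=> z /Ww[].
have Gw := the_gameP RG w; split=> //.
apply: (similar_glue (c := c)) => // z zL nDz.
by have [/(_ nDz)[g [[Gg Sg] gz]] _] := Ww z zL; exists g.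
Qed.

Lemma Aev_measurable S : measurable (Aev tree S).
Proof.
case: RG => _ _ mt _.
exact: (mt [set t | (S `<=` t)%fset /\ inter t (Dset [set` leaves S]) = fset0]).
Qed.

Lemma given_measurable : measurable E.
Proof. exact: the_game_rv. Qed.

Lemma given_gt0 : 0 < fine (P E).
Proof.
rewrite lt_neqAle fine_ge0 ?measure_ge0// andbT eq_sym fine_eq0//.
by apply: fin_num_measure; exact: given_measurable.
Qed.

Let a z (W : set game) := condP P (Aev tree T) (sub z @^-1` (compatible z `&` W)).

Lemma given_sub_Aev : E `<=` Aev tree T.
Proof.
move=> w Ew; have : (E `&` \bigcap_(z in [set` L]) (sub z @^-1` setT)) w by [].
by rewrite (given_Aev (fun=> setT)) => -[].
Qed.

Lemma Aev_gt0 : (0 < P (Aev tree T))%E.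
Proof.
rewrite lt_neqAle measure_ge0 andbT eq_sym; apply: contra_neqN PE => /eqP PA0.
apply/eqP; rewrite eq_le measure_ge0 andbT -PA0 le_measure ?inE//.
- exact: given_measurable.
- exact: Aev_measurable.
- exact: given_sub_Aev.
Qed.

Lemma fine_Aev_gt0 : 0 < fine (P (Aev tree T)).
Proof.
have := Aev_gt0; rewrite -(@fineK _ (P (Aev tree T)))//.
by apply: fin_num_measure; exact: Aev_measurable.
Qed.

Lemma given_prod (W : word -> set game) :
  fine (P (E `&` \bigcap_(z in [set` L]) (sub z @^-1` W z))) =
  fine (P (Aev tree T)) * \prod_(z <- L) a z (W z).
Proof.
have FT : is_ftree T by apply: Kset_ftree; case: G0.
rewrite given_Aev -(BR FT Aev_gt0) /condP mulrC divfK//.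
by rewrite gt_eqF// fine_Aev_gt0.
Qed.

Lemma given_prodT : fine (P E) = fine (P (Aev tree T)) * \prod_(z <- L) a z setT.
Proof. by rewrite -given_prod bigcapT ?setIT. Qed.

(** In the quotient of the two products, every factor except that of [y] cancels. *)
Lemma given_one y W : y \in L -> condP P E (sub y @^-1` W) = a y W / a y setT.
Proof.
move=> yL; rewrite /condP given_prodT.
have -> : sub y @^-1` W `&` E =
    E `&` \bigcap_(z in [set` L]) (sub z @^-1` (if z == y then W else setT)).
  rewrite setIC; congr (_ `&` _); apply/seteqP; split=> w /=.
    by move=> Ww z _ /=; case: eqP => [->|].
  by move=> /(_ y yL) /=; rewrite eqxx.
have prodL f : \prod_(z <- L) f z = f y * \prod_(z <- (L `\ y)%fset) f z :> R.
  exact: big_fsetD1.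
rewrite given_prod !prodL eqxx.
rewrite (eq_big_seq (fun z => a z setT)); last first.
  by move=> z; rewrite in_fsetD1 => /andP[/negbTE ->].
have := given_gt0; rewrite given_prodT prodL.
set r := \prod_(z <- _) _; set A := fine _ => h.
have A0 : A != 0 by rewrite gt_eqF// fine_Aev_gt0.
(* The class has positive probability, so the cancelled factors do not vanish. *)
have r0 : r != 0 by apply: contraTneq h => ->; rewrite !mulr0 ltxx.
by rewrite -mulf_div divff// mul1r -mulf_div divff// mulr1.
Qed.

(** The joint probability and that of [E] are both products over [L]; their quotient, taken leaf by
    leaf, is the product of the marginals found in [given_one]. *)
Lemma given_indep (W : word -> set game) :
  condP P E (\bigcap_(z in [set` L]) (sub z @^-1` W z)) =
  \prod_(z <- L) condP P E (sub z @^-1` W z).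
Proof.
rewrite (eq_big_seq (fun z => a z (W z) / a z setT)); last by move=> z; exact: given_one.
rewrite /condP setIC given_prod given_prodT -mulf_div divff ?mul1r.
  by rewrite -prodf_div.
by rewrite gt_eqF// fine_Aev_gt0.
Qed.

Lemma given_indep_sub (Y : {fset word}) (W : word -> set game) : (Y `<=` L)%fset ->
  condP P E (\bigcap_(z in [set` Y]) (sub z @^-1` W z)) =
  \prod_(z <- Y) condP P E (sub z @^-1` W z).
Proof.
move=> YL; have EY : \bigcap_(z in [set` Y]) (sub z @^-1` W z) =
   \bigcap_(z in [set` L]) (sub z @^-1` (if z \in Y then W z else setT)).
  apply/seteqP; split=> w Ww z /= zY.
    by case: ifP => // /Ww.
  by have := Ww z (fsubsetP YL z zY); rewrite /= zY.
have ET : condP P E setT = 1.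
  by rewrite /condP setTI divff// gt_eqF// given_gt0.
rewrite EY given_indep (bigID (mem Y))/= [X in _ * X]big1 ?mulr1; last first.
  by move=> z /negbTE ->; rewrite preimage_setT.
rewrite -big_filter.
rewrite (perm_big Y)/=; last first.
  apply: uniq_perm; rewrite ?filter_uniq ?fset_uniq// => z.
  by rewrite mem_filter; apply: andb_idr; exact: (fsubsetP YL).
by apply: eq_big_seq => z ->.
Qed.

(** At a node of [Dset X] the class imposes nothing, so conditioning on [E] leaves the subgame at
    [c] with its law given [Aev tree T]. *)
Lemma given_win_Dset : Dset [set` X] c ->
  condP P E (win tree out c) = mval P tree out T c.
Proof.
move=> Dc; have cL : c \in L by exact: Kset_leaf.
rewrite win_subgame given_one// /a compatible_Dset// !setTI /mval win_subgame.
rewrite preimage_setT {2}/condP setTI divff ?divr1// gt_eqF//; exact: fine_Aev_gt0.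
Qed.

Lemma condP_ext (A B : set Om) : A `&` E = B `&` E -> condP P E A = condP P E B.
Proof. by rewrite /condP => ->. Qed.

Lemma condP_setC (A : set Om) : measurable A -> condP P E (~` A) = 1 - condP P E A.
Proof.
move=> mA; have mE := given_measurable.
have fin B : measurable B -> P B \is a fin_num by exact: fin_num_measure.
have PD : P E = (P (~` A `&` E) + P (A `&` E))%E.
  by rewrite [in RHS]setIC -setDE [in RHS](setIC A); exact: measureDI.
have E0 : fine (P E) != 0 by rewrite gt_eqF// given_gt0.
apply: (mulIf E0); rewrite mulrBl /condP !divfK// mul1r PD fineD ?addrK//.
- by apply: fin; apply: measurableI => //; exact: measurableC.
- by apply: fin; exact: measurableI.
Qed.

(** With the trace taken at a child [c] of [y], all the children of [y] are leaves of [T], hence win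
    independently given [E]. *)
Lemma given_win_node y : children y c -> Bset [set` X] c -> 
  condP P E (win tree out y) =
    (turn y == 0%N)%:R * \prod_(u <- inter g0.1 (children y)) condP P E (win tree out u) +
    (turn y == 1%N)%:R *
      (1 - \prod_(u <- inter g0.1 (children y)) (1 - condP P E (win tree out u))).
Proof.
move=> yc Bc; set Y := inter g0.1 (children y).
have [b cE] : exists b, c = rcons y b by exact/children_rcons.
have yP : prefix y c by rewrite cE; exact: prefix_rcons.
have KY : children y `<=` Kset c.
  move=> u /children_rcons[e ->]; rewrite cE.
  have [->|eb] := eqVneq (rcons y e) (rcons y b); first exact: Kset_refl.
  apply: Kset_brothers (Kset_refl _) _; apply/brothers_rcons; split; first by exists e.
  exact/eqP.
have YL : (Y `<=` L)%fset.
  apply/fsubsetP => u /interP[u0 yu]; rewrite /L /T.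
  (* Brothers have the same [Kset], and a node is a leaf of its own trace. *)
  suff -> : Kset c = Kset u by exact: Kset_leaf.
  have [->//|uc] := eqVneq u c; apply: Kset_brothersE.
  case/children_rcons: yu uc => e -> uc; rewrite cE in uc *.
  apply/brothers_rcons; split; first by exists b.
  by apply/nesym/eqP.
have YE w : E w -> inter (tree w) (children y) = Y.
  move=> [Gw Sw]; apply/fsetP => u; rewrite !in_inter.
  have [/set_mem yu|_] := boolP (u \in children y); rewrite ?andbF// !andbT.
  by apply: similar_mem Sw _ => //; apply: Kset_BD (KY _ yu).
have cw w : E w -> c \in tree w.
  by move=> [Gw Sw]; rewrite (similar_mem G0 Gw X0 Sw)//; left.
have yw w : E w -> y \in tree w.
  by move=> Ew; apply: ftree_prefix (cw _ Ew) yP; case: RG.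
have ynl w : E w -> y \notin leaves (tree w).
  move=> Ew; apply/negP => /leavesP[_ /(_ c (cw _ Ew) yP)].
  by rewrite cE => /(congr1 size); rewrite size_rcons => /esym/n_Sn.
have winY w u : E w -> u \in Y -> win tree out u w <-> minimax (tree w) (out w) u.
  move=> Ew; rewrite -(YE _ Ew) => /interP[uw _].
  by split=> [[]|].
have [ty|ty] := eqVneq (turn y) 0%N.
  rewrite ty mul0r addr0 mul1r.
  under eq_bigr do rewrite win_subgame; rewrite -given_indep_sub//.
  apply: condP_ext; apply/seteqP; split=> w [H Ew]; split=> //.
    case: H => _; rewrite minimax_node ?yw ?ynl// ty/= YE// big_all => /allP yW.
    by move=> u /= uY; apply/winP/winY => //; exact: yW.
  split; first exact: yw.
  rewrite minimax_node ?yw ?ynl// ty/= YE// big_all; apply/allP => u uY.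
  by apply/winY => //; apply/winP; exact: H.
have t1 : turn y = 1%N by move: ty; rewrite /turn; case: odd.
rewrite t1 mul0r add0r mul1r.
(* At a maximum the complements are used: [y] is lost when all its children are, and losses are
   events of the subgames as well. *)
have -> : \prod_(u <- Y) (1 - condP P E (win tree out u)) =
    \prod_(u <- Y) condP P E (sub u @^-1` ~` winning u).
  apply: eq_bigr => u _; rewrite -condP_setC; last exact: win_measurable.
  by rewrite win_subgame preimage_setC.
rewrite -given_indep_sub// -condP_setC; last first.
  have -> : \bigcap_(z in [set` Y]) (sub z @^-1` ~` winning z) =
      G @^-1` [set g | forall z, z \in Y -> ~ winning z (below z g)] by [].
  exact: the_game_rv.
apply: condP_ext; apply/seteqP; split=> w [H Ew]; split=> //.
  case: H => _; rewrite minimax_node ?yw ?ynl// t1/= YE// big_has => /hasP[u uY uW].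
  by move=> /(_ u uY); apply; apply/winP/winY.
split; first exact: yw.
rewrite minimax_node ?yw ?ynl// t1/= YE// big_has; apply: contrapT => /negP/hasPn nW.
apply: H => u uY /= /winP uW; have /negP := nW u uY; apply.
exact/(winY _ _ Ew uY).
Qed.

End Given.
End Branching.

(** * Conditioning on the observations *)

(** The events on a discrete observation already form a sigma-algebra, so the level set of [Z]
    through [w'] is a union of fibres of [observed]. *)
Lemma Fsigma_fiber (d : measure_display) (Om : measurableType d) (R : realType)
    (tree : Om -> {fset word}) (out : Om -> {fmap word -> bool})
    (x : nat -> Om -> word) k (Z : Om -> R) w w' :
  (forall B : set R, measurable B -> Fsigma tree out x k (Z @^-1` B)) ->
  observed tree out x k w = observed tree out x k w' -> Z w = Z w'.
Proof.
move=> mZ ww'; have /mZ : measurable [set Z w'] by exact: measurable_set1.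
have sD : sigma_algebra setT (discrete_events (observed tree out x k)).
  exact: sigma_algebra_preimage.
move=> /(smallest_sub sD (@subset_refl _ _)) [S _]; rewrite setTI => SE.
have : (observed tree out x k @^-1` S) w' by rewrite SE.
rewrite /preimage /= -ww' => Sw.
by have : (observed tree out x k @^-1` S) w by []; rewrite SE.
Qed.

(** * Atoms of the observations *)

Section Atoms.
Context (d : measure_display) (Om : measurableType d) (R : realType).
Variable P : probability Om R.
Variables (tree : Om -> {fset word}) (out : Om -> {fmap word -> bool}).
Variables (x : nat -> Om -> word) (U : nat -> {RV P >-> R}).
Variable F : {fset word} -> {fset word} -> {fmap word -> bool} -> R -> word.
Hypothesis RG : random_game tree out.
Hypothesis adm : admissible tree out x U F.
Variable k : nat.
Hypothesis k1 : (1 <= k)%N.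
Local Notation G := (the_game tree out).
Local Notation obs := (observed tree out x k).

Definition atom (w0 : Om) : set Om := [set w | obs w = obs w0].

Lemma observed_rv : discrete_rv obs.
Proof.
apply: (discrete_in_comp (fun p : {fset word} * game =>
  (p.1, inter p.2.1 (Dset [set` p.1]), p.2.2.[& p.1]%fmap))
  (Y := fun w => (xs x k w, G w))).
apply: discrete_in_pair; [exact: sigma_algebra_measurable| |exact: the_game_rv].
exact: xs_rv adm _.
Qed.

Lemma atom_measurable w0 : measurable (atom w0).
Proof. exact: observed_rv [set o | o = obs w0]. Qed.

(** The observation takes countably many values, so the null atoms together form a null set. *)
Lemma ae_atom : {ae P, forall w, P (atom w) != 0%E}.
Proof.
have : {ae P, forall w, forall o, obs w = o -> P (obs @^-1` [set o]) != 0%E}.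
  apply: ae_forall_count => o.
  have [Po|Po] := eqVneq (P (obs @^-1` [set o])) 0%E; last by apply: aeW.
  exists (obs @^-1` [set o]); split=> //; first exact: observed_rv.
  by move=> w /= no; apply: contrapT => wo; apply: no => /wo.
by apply: filterS => w /(_ _ erefl).
Qed.

(** This separates a condition on the game from one on the leaves found, to which [xs_free]
    applies. *)
Lemma atomE w0 : (xs x k w0 `<=` leaves (tree w0))%fset ->
  atom w0 = G @^-1` alike (xs x k w0) (G w0) `&` [set w | xs x k w = xs x k w0].
Proof.
move=> X0; apply/seteqP; split=> w /=.
  move=> ow; have XE : xs x k w = xs x k w0 := congr1 (fun o => o.1.1) ow.
  have DE := congr1 (fun o => o.1.2) ow; have oE := congr1 snd ow.
  rewrite /= /Dxs XE in DE oE; split=> //; split; first exact: the_gameP.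
  (* Equal restricted outcome maps have equal domains, which puts the leaves found at [w0] among the
     leaves of the tree at [w]. *)
  split=> //; have /(congr1 (fun o : {fmap word -> bool} => domf o)) := oE.
  by case: RG => _ O0 _ _; rewrite !domf_restrict !O0 (fsetIidPl X0) => /fsetIidPl.
by move=> [[_ [_ /= DE oE]] XE]; rewrite /atom /observed /= /Dxs XE DE oE.
Qed.

(** By [xs_free], these leaves are found with the same conditional probability [q] on every part of
    the class; this factor cancels. *)
Lemma atom_condP w0 y : (xs x k w0 `<=` leaves (tree w0))%fset -> P (atom w0) != 0%E ->
  P (G @^-1` alike (xs x k w0) (G w0)) != 0%E /\
  condP P (atom w0) (win tree out y) =
    condP P (G @^-1` alike (xs x k w0) (G w0)) (win tree out y).
Proof.
move=> X0 P0; have [q qE] := xs_free RG adm k1 (the_gameP RG w0) X0.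
set E := alike _ _ in qE *.
have PA : P (atom w0) = (q%:E * P (G @^-1` E))%E by rewrite atomE// qE.
have PE : P (G @^-1` E) != 0%E by apply: contraNneq P0 => PE; rewrite PA PE mule0.
have q0 : q != 0 by apply: contraNneq P0 => q0; rewrite PA q0 mul0e.
split=> //; rewrite /condP PA.
have -> : win tree out y `&` atom w0 =
    G @^-1` (winning y `&` E) `&` [set w | xs x k w = xs x k w0].
  by rewrite atomE// setIA.
have fin S : P (G @^-1` S) \is a fin_num by apply: fin_num_measure; exact: the_game_rv.
rewrite qE; last exact: subIsetr.
by rewrite !fineM//= -mulf_div divff// mul1r.
Qed.

(** A version is constant on an atom, and its integral over a non-null atom fixes the constant. *)
Lemma atom_version w0 Ev Z : is_cond_prob P (Fsigma tree out x k) Ev Z ->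
  P (atom w0) != 0%E -> Z w0 = condP P (atom w0) Ev.
Proof.
move=> ZE P0; have [mZ _ _] := ZE.
have fin : P (atom w0) \is a fin_num by apply: fin_num_measure; exact: atom_measurable.
rewrite /condP (is_cond_prob_cst ZE (c := Z w0)).
- by rewrite fineM//= mulfK// fine_eq0.
- by apply: sub_sigma_algebra; exists [set o | o = obs w0] => //; rewrite setTI.
- exact: atom_measurable.
- by move=> w; exact: Fsigma_fiber mZ.
Qed.

End Atoms.

Theorem proposition9 (d : measure_display) (Om : measurableType d)
  (R : realType) (P : probability Om R)
  (tree : Om -> {fset word}) (out : Om -> {fmap word -> bool})
  (x : nat -> Om -> word) (U : nat -> {RV P >-> R})
  (F : {fset word} -> {fset word} -> {fmap word -> bool} -> R -> word)
  (n : nat) (Rn : word -> Om -> R) :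
  random_game tree out ->
  branching P tree out ->
  admissible tree out x U F ->
  (1 <= n)%N ->
  (forall y : word,
     is_cond_prob P (Fsigma tree out x n) (win tree out y) (Rn y)) ->
  {ae P, forall w : Om,
    [/\ forall y, y \in xs x n w ->
          Rn y w = (minimax (tree w) (out w) y)%:R,
        forall y, y \in Dxs tree x n w ->
          Rn y w = mval P tree out (inter (tree w) (Kset y)) y &
        forall y, y \in Bxs x n w -> y \notin xs x n w ->
          Rn y w =
            (turn y == 0%N)%:R *
              \prod_(c <- inter (tree w) (children y)) Rn c w +
            (turn y == 1%N)%:R *
              (1 - \prod_(c <- inter (tree w) (children y)) (1 - Rn c w))]}.
Proof.
move=> RG BR adm n1 Rcond.
move: (xs_leaves RG adm n1) (ae_atom RG adm n).
apply: filterS2 => w0 X0 P0; set X := xs x n w0 in X0 *.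
have G0 := the_gameP RG w0; set g0 := the_game tree out w0 in G0.
set E := the_game tree out @^-1` alike X g0.
(* The word [root] is arbitrary here. *)
have PE : P E != 0%E by have [] := atom_condP RG adm n1 root X0 P0.
(* The non-null atom fixes every version at [w0], so this holds for all words at once. *)
have RE y : Rn y w0 = condP P E (win tree out y).
  rewrite (atom_version RG adm (Rcond y) P0).
  by have [] := atom_condP RG adm n1 y X0 P0.
split=> y.
- move=> yX; have yl : y \in leaves (tree w0) by apply/fsubsetP: yX.
  (* The value at a leaf found is the same throughout the class, so its conditional probability is
     zero or one. *)
  have mE w : E w ->
      y \in tree w /\ minimax (tree w) (out w) y = minimax (tree w0) (out w0) y.
    move=> [_ [/fsubsetP Xw _ oE]]; have ylw : y \in leaves (tree w) by exact: Xw.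
    split; first exact: leavesW.
    have /(congr1 (fun o : {fmap word -> bool} => o.[? y]%fmap)) := oE.
    by rewrite !minimax_leaf// !fnd_restrict yX /= => ->.
  rewrite RE /condP; case m0 : (minimax _ _ y) in mE *.
    have -> : win tree out y `&` E = E by apply/setIidr => w /mE[].
    by rewrite divff// gt_eqF// given_gt0.
  have -> : win tree out y `&` E = set0.
    by apply/seteqP; split=> // w [[_ yw] /mE[_]]; rewrite yw.
  by rewrite measure0 mul0r.
- move=> /interP[y0 Dy]; rewrite RE.
  by apply: (given_win_Dset RG BR G0 X0 _ _ PE) => //; right.
(* [Bxs] is built with [fset_set], which is meaningful on finite sets only. *)
- have finB : finite_set (Bset [set` X]).
    apply: sub_finite_set (finite_fset (tree w0)); apply: Bset_tree; first by case: G0.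
    by move=> v /= vX; apply: leavesW; exact: (fsubsetP X0).
  rewrite /Bxs in_fset_set// => /set_mem/BsetP[v vX yv] yX.
  (* The trace is taken at the child of [y] towards a leaf [v] found below it. *)
  have [b bv] : exists b, prefix (rcons y b) v.
    case/prefixP: yv vX => -[|b s] ->; first by rewrite cats0 /= (negbTE yX).
    by exists b; rewrite -cat_rcons prefix_prefix.
  have Bc : Bset [set` X] (rcons y b) by apply/BsetP; exists v.
  have c0 : rcons y b \in tree w0.
    apply: Bset_tree Bc; first by case: G0.
    by move=> u /= uX; apply: leavesW; exact: (fsubsetP X0).
  under eq_bigr do rewrite RE; under [in X in _ + X]eq_bigr do rewrite RE.
  rewrite RE; apply: (given_win_node RG BR G0 X0 c0 _ PE) => //; first by left.
  by apply/children_rcons; exists b.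
Qed.
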